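(* The limit of the Fučík spectrum $\Sigma_p$ as $p\to\infty$, when $\Omega$ is the unit interval $(0,1)\subset\mathbb{R}$, is given by $$\Sigma_\infty=\bigcup_{k=1}^{\infty}\mathcal{C}_{k,\infty}^{\pm},$$ where $$\mathcal{C}_{k,\infty}=\left\{\left(k(1+s^{-1}),\,k(1+s)\right):\ s\in\mathbb{R}^+\right\}\quad\text{if }k\text{ is even},$$ $$\mathcal{C}_{k,\infty}^{+}=\left\{\left(k-1+s^{-1}(k+1),\ k+1+s(k-1)\right):\ s\in\mathbb{R}^+\right\}\quad\text{if }k\text{ is odd},$$ $$\mathcal{C}_{k,\infty}^{-}=\left\{\left(k+1+s^{-1}(k-1),\ k-1+s(k+1)\right):\ s\in\mathbb{R}^+\right\}\quad\text{if }k\text{ is odd}.$$ (For even $k$, the symbol $\mathcal{C}_{k,\infty}^{\pm}$ in the union means the single curve $\mathcal{C}_{k,\infty}$.)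
   Context: Notation: $\mathbb{R}^+=(0,\infty)$ and $u^\pm=\max\{0,\pm u\}$. For a bounded smooth domain $\Omega\subset\mathbb{R}^n$, $\Delta_pu=\mathrm{div}(|\nabla u|^{p-2}\nabla u)$ and $\Delta_\infty u=\sum_{i,j}\frac{\partial u}{\partial x_j}\frac{\partial^2u}{\partial x_j\partial x_i}\frac{\partial u}{\partial x_i}$; here $\Omega=(0,1)$, $n=1$. The Fučík spectrum $\Sigma_p$ is the set of $(\alpha_p,\beta_p)\in\mathbb{R}^2$ for which there is a nontrivial solution $u$ of $-\Delta_pu=\alpha_p(u^+)^{p-1}-\beta_p(u^-)^{p-1}$ in $\Omega$, $u=0$ on $\partial\Omega$. The $\infty$-Fučík spectrum $\Sigma_\infty$ is the set of $(\alpha,\beta)\in\mathbb{R}^2$ for which there is a nontrivial viscosity solution $u$ of the problem $\min\{-\Delta_\infty u,\ |\nabla u|-\alpha u^+\}=0$ in $\{u>0\}\cap\Omega$; $\max\{-\Delta_\infty u,\ -|\nabla u|+\beta u^-\}=0$ in $\{u<0\}\cap\Omega$; $-\Delta_\infty u=0$ in $\{u=0\}\cap\Omega$; $u=0$ on $\partial\Omega$. This is the problem satisfied by uniform limits, as $p\to\infty$, of eigenfunctions for $(\alpha_p,\beta_p)\in\Sigma_p$ normalized in $L^p(\Omega)$, with $(\alpha,\beta)=\lim(\alpha_p^{1/p},\beta_p^{1/p})$.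
   Formalization: The identity of Σ_∞ with the curves is stated for α,β>0, since e.g. (2,−1) lies in Σ_∞ but on no curve; outside, Σ_∞ is shown to be {2}×(−∞,0] and (−∞,0]×{2}, and the limit of the p-th roots of Σ_p is Σ_∞ with α,β≥0. *)

(* Defs.v *)
From Stdlib Require Import Reals Lra Lia Psatz Arith.
From Coquelicot Require Import Coquelicot.
Open Scope R_scope.

Definition Omega (x : R) : Prop := 0 < x < 1.
Definition Omega_closure (x : R) : Prop := 0 <= x <= 1.

Definition pos_part (t : R) : R := Rmax 0 t.
Definition neg_part (t : R) : R := Rmax 0 (- t).

(* [t ^ r] for [0 <= t], with [0 ^ r = 0]; [Rpower 0 r] is [1] in the standard
   library, which is not the power occurring in the p-Laplace equation. *)
Definition rpow (t r : R) : R := if Rlt_dec 0 t then Rpower t r else 0.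

Definition continuous_dirichlet (u : R -> R) : Prop :=
  continuous_on Omega_closure u /\ u 0 = 0 /\ u 1 = 0.

Definition nontrivial (u : R -> R) : Prop := exists x, Omega x /\ u x <> 0.

(* |u'|^(p-2) u' *)
Definition p_flux (p : R) (u : R -> R) (x : R) : R :=
  rpow (Rabs (Derive u x)) (p - 2) * Derive u x.

Definition p_laplacian (p : R) (u : R -> R) (x : R) : R :=
  Derive (p_flux p u) x.

(* In dimension one, weak solutions in W_0^{1,p} have a C^1 flux, so that the
   equation holds pointwise; conversely the conditions below make the flux,
   hence [u'], continuous and bounded on Omega. *)
Definition p_fucik_solution (p a b : R) (u : R -> R) : Prop :=
  continuous_dirichlet u /\
  forall x, Omega x ->
    ex_derive u x /\
    ex_derive (p_flux p u) x /\
    - p_laplacian p u x =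
      a * rpow (pos_part (u x)) (p - 1) - b * rpow (neg_part (u x)) (p - 1).

Definition Sigma_p (p : R) (z : R * R) : Prop :=
  exists u, nontrivial u /\ p_fucik_solution p (fst z) (snd z) u.

Definition C2_on_Omega (phi : R -> R) : Prop :=
  forall x, Omega x ->
    ex_derive phi x /\ ex_derive (Derive phi) x /\
    continuous (Derive_n phi 2) x.

Definition infty_laplacian (phi : R -> R) (x : R) : R :=
  Derive phi x * Derive_n phi 2 x * Derive phi x.

(* [F phi x0] is the value at [x0] of the differential operator on the test
   function. Contact is required on a full neighbourhood of [x0], also when
   the equation is imposed only on a non-open set of points. *)
Definition viscosity_sub_at (F : (R -> R) -> R -> R) (u : R -> R) (x0 : R) :=
  forall phi, C2_on_Omega phi ->
    locally x0 (fun y => u y - phi y <= u x0 - phi x0) -> F phi x0 <= 0.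

Definition viscosity_super_at (F : (R -> R) -> R -> R) (u : R -> R) (x0 : R) :=
  forall phi, C2_on_Omega phi ->
    locally x0 (fun y => u x0 - phi x0 <= u y - phi y) -> 0 <= F phi x0.

Definition viscosity_at (F : (R -> R) -> R -> R) (u : R -> R) (x0 : R) :=
  viscosity_sub_at F u x0 /\ viscosity_super_at F u x0.

Definition infty_fucik_solution (alpha beta : R) (u : R -> R) : Prop :=
  continuous_dirichlet u /\
  forall x0, Omega x0 ->
    (0 < u x0 ->
       viscosity_at (fun phi x => Rmin (- infty_laplacian phi x)
                        (Rabs (Derive phi x) - alpha * pos_part (u x))) u x0) /\
    (u x0 < 0 ->
       viscosity_at (fun phi x => Rmax (- infty_laplacian phi x)
                        (- Rabs (Derive phi x) + beta * neg_part (u x))) u x0) /\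
    (u x0 = 0 ->
       viscosity_at (fun phi x => - infty_laplacian phi x) u x0).

Definition Sigma_infty (z : R * R) : Prop :=
  exists u, nontrivial u /\ infty_fucik_solution (fst z) (snd z) u.

Definition curve_even (k : nat) (z : R * R) : Prop :=
  exists s, 0 < s /\ z = (INR k * (1 + / s), INR k * (1 + s)).

Definition curve_plus (k : nat) (z : R * R) : Prop :=
  exists s, 0 < s /\
    z = (INR k - 1 + / s * (INR k + 1), INR k + 1 + s * (INR k - 1)).

Definition curve_minus (k : nat) (z : R * R) : Prop :=
  exists s, 0 < s /\
    z = (INR k + 1 + / s * (INR k - 1), INR k - 1 + s * (INR k + 1)).

Definition infty_curves (z : R * R) : Prop :=
  exists k : nat, (1 <= k)%nat /\
    ((Nat.Even k /\ curve_even k z) \/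
     (Nat.Odd k /\ (curve_plus k z \/ curve_minus k z))).

Definition positive_quadrant (z : R * R) : Prop := 0 < fst z /\ 0 < snd z.
Definition nonneg_quadrant (z : R * R) : Prop := 0 <= fst z /\ 0 <= snd z.

(* The points (a^(1/p), b^(1/p)) with (a, b) in Sigma_p; p-th roots are real
   only for nonnegative a and b. *)
Definition Sigma_p_rescaled (p : R) (w : R * R) : Prop :=
  exists z, Sigma_p p z /\ nonneg_quadrant z /\
    w = (rpow (fst z) (/ p), rpow (snd z) (/ p)).

(* Painleve-Kuratowski lower and upper limits of S p as p tends to infinity. *)
Definition lower_limit (S : R -> R * R -> Prop) (z : R * R) : Prop :=
  forall eps : posreal,
    Rbar_locally p_infty (fun p => exists w, S p w /\ ball z eps w).

Definition upper_limit (S : R -> R * R -> Prop) (z : R * R) : Prop :=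
  forall (eps : posreal) (P : R),
    exists p, P < p /\ exists w, S p w /\ ball z eps w.

Definition is_set_limit (S : R -> R * R -> Prop) (L : R * R -> Prop) : Prop :=
  forall z, (lower_limit S z <-> L z) /\ (upper_limit S z <-> L z).

(* Main.v *)
Require Import Defs.
From Stdlib Require Import Reals Lra Lia Psatz Arith.
From Coquelicot Require Import Coquelicot.
From Stdlib Require Import Ranalysis5 Classical FunctionalExtensionality.
Open Scope R_scope.

(* In both problems the interval is cut into finitely many nodal arcs of
   alternating sign, and the two spectra are read off from the lengths of the
   arcs. For the limit problem an arc is a tent with slopes [+-1] up to a factor,
   of length exactly [2 / alpha] or [2 / beta]: touching a positive arc by
   parabolas shows that it is concave, that its maximum lies at distance at least
   [1 / alpha] (subsolution) and at most [1 / alpha] (supersolution) from either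
   end, and that the solution changes sign at its ends. For the p-problem, with
   [alpha = a^(1/p)] and [beta = b^(1/p)], two applications of the mean value
   theorem to [u] and to its flux give [1 <= a h^p <= e p] for each half [h] of a
   positive arc, so that the lengths are those of the limit problem up to a
   factor [(e p)^(1/p) -> 1]. Conversely, copies of a p-bump, resp. of a tent, are
   glued with equal slopes at the zeros. *)

(** * Nodal arcs *)

(** The two spectra are compared only through [tiled r], where [r] measures by how much arcs may
    exceed their ideal length: [r = 1] characterizes the limit problem, while the p-problem gives
    [r = (e p)^(1/p)]. Letting [r] tend to 1 requires tilings to form a closed condition, which
    rests on a lower bound for arc lengths, hence an upper bound for their number. The same lower
    bound, with the sign change at both ends of an arc, prevents zeros from accumulating or filling
    intervals. A solution of one sign has a single arc and leaves the other rate free; this is the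
    source of the two half-lines of [Sigma_infty] outside the positive quadrant, and [tiled]
    accordingly asks for positivity only of the rates that occur. The infinity Laplacian in
    dimension one is [u'^2 u''], which says nothing about [u''] where the slope vanishes; concavity
    is therefore proved along chords of nonzero slope, horizontal ones being tilted. In the
    p-problem the constant [e p] arises from comparing the solution at the fraction [1 - 1/p] of the
    half arc, the best choice for this estimate. *)

Lemma locally_R (x : R) (P : R -> Prop) :
  locally x P <-> exists e, 0 < e /\ forall y, Rabs (y - x) < e -> P y.
Proof.
  split.
  - intros [e He]. exists (pos e). split; [apply cond_pos | exact He].
  - intros [e [He H]]. exists (mkposreal e He). exact H.
Qed.

Lemma continuous_pos_nbhd (v : R -> R) (x : R) :
  continuous v x -> 0 < v x ->
  exists e, 0 < e /\ forall y, Rabs (y - x) < e -> 0 < v y.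
Proof.
  intros Hv Hx. apply locally_R.
  apply (Hv (fun t => 0 < t)). apply locally_R.
  exists (v x). split; [exact Hx |].
  intros t Ht. apply Rabs_def2 in Ht. lra.
Qed.

(** Differentiability is asked only inside the interval, since at 0 and 1 a solution is known merely
    to be continuous. *)
Lemma mean_value (f df : R -> R) (a b : R) :
  a < b ->
  (forall x, a < x < b -> is_derive f x (df x)) ->
  (forall x, a <= x <= b -> continuous f x) ->
  exists c, a < c < b /\ f b - f a = df c * (b - a).
Proof.
  intros Hab Hd Hc.
  assert (pr1 : forall c, a < c < b -> derivable_pt f c).
  { intros c H. exists (df c). apply is_derive_Reals. now apply Hd. }
  assert (pr2 : forall c, a < c < b -> derivable_pt id c).
  { intros c _. apply derivable_pt_id. }
  destruct (MVT f id a b pr1 pr2 Hab) as [c [P E]].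
  - intros c H. apply continuity_pt_filterlim. now apply Hc.
  - intros c _. apply derivable_continuous_pt, derivable_pt_id.
  - exists c. split; [exact P |].
    replace (derive_pt f c (pr1 c P)) with (df c) in E.
    + rewrite (pr_nu id c (pr2 c P) (derivable_pt_id c)) in E.
      rewrite derive_pt_id in E. unfold id in E. lra.
    + symmetry. apply derive_pt_eq_0. apply is_derive_Reals. now apply Hd.
Qed.

(** The zero is the supremum of the points up to which [v] stays positive; continuity there excludes
    both a positive and a negative value. *)
Lemma first_zero (v : R -> R) (a b : R) :
  (forall x, continuous v x) -> a < b -> 0 < v a -> v b <= 0 ->
  exists d, a < d <= b /\ v d = 0 /\ forall y, a <= y < d -> 0 < v y.
Proof.
  intros Hc Hab Ha Hb.
  set (E := fun t => a <= t <= b /\ forall y, a <= y <= t -> 0 < v y).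
  destruct (completeness E) as [d [Hub Hlub]].
  - exists b. intros t [Ht _]. lra.
  - exists a. split; [lra |]. intros y Hy. now replace y with a by lra.
  - assert (Ed : a <= d <= b).
    { split.
      - apply Hub. split; [lra |]. intros y Hy. now replace y with a by lra.
      - apply Hlub. intros t [Ht _]. lra. }
    assert (Hpos : forall y, a <= y < d -> 0 < v y).
    { intros y Hy. apply NNPP. intros N.
      assert (d <= y); [| lra].
      apply Hlub. intros t [Ht Ht']. apply Rnot_lt_le. intros L.
      apply N, Ht'. lra. }
    assert (Hle : v d <= 0).
    { apply Rnot_lt_le. intros P.
      destruct (continuous_pos_nbhd v d (Hc d) P) as [e [He Hn]].
      assert (Hdb : d < b).
      { destruct (Req_dec d b) as [-> |]; lra. }
      assert (Rmin b (d + e / 2) <= d); [| unfold Rmin in *; destruct Rle_dec; lra].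
      apply Hub. split.
      - unfold Rmin; destruct Rle_dec; lra.
      - intros y Hy. destruct (Rlt_dec y d) as [L | L].
        + apply Hpos. lra.
        + apply Hn. assert (y <= d + e / 2) by (unfold Rmin in Hy; destruct Rle_dec; lra).
          apply Rabs_def1; lra. }
    assert (Had : a < d).
    { destruct (Req_dec a d) as [-> |]; lra. }
    exists d. split; [lra |]. split; [| exact Hpos].
    apply Rle_antisym; [exact Hle |]. apply Rnot_lt_le. intros N.
    destruct (continuous_pos_nbhd (fun x => - v x) d) as [e [He Hn]].
    + apply (continuous_opp v d (Hc d)).
    + lra.
    + set (y := Rmax a (d - e / 2)).
      assert (a <= y < d /\ d - e / 2 <= y)
        by (unfold y, Rmax; destruct Rle_dec; lra).
      assert (0 < v y) by (apply Hpos; lra).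
      assert (0 < - v y) by (apply Hn; apply Rabs_def1; lra). lra.
Qed.

Lemma continuous_reflect (u : R -> R) :
  (forall x, continuous u x) -> forall x, continuous (fun y => u (1 - y)) x.
Proof.
  intros H x. apply (continuous_comp (fun y => 1 - y) u x); [| apply H].
  apply (continuous_minus (fun _ => 1) (fun y : R => y));
    [apply continuous_const | apply continuous_id].
Qed.

Lemma last_zero (v : R -> R) (a b : R) :
  (forall x, continuous v x) -> a < b -> v a <= 0 -> 0 < v b ->
  exists c, a <= c < b /\ v c = 0 /\ forall y, c < y <= b -> 0 < v y.
Proof.
  intros Hc Hab Ha Hb.
  destruct (first_zero (fun x => v (- x)) (- b) (- a)) as [d [Hd [H0 Hp]]].
  - intros x. apply (continuous_comp Ropp v x); [| apply Hc].
    apply (continuous_opp (fun x : R => x)), continuous_id.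
  - lra.
  - now rewrite Ropp_involutive.
  - now rewrite Ropp_involutive.
  - exists (- d). split; [lra |]. split; [exact H0 |].
    intros y Hy. rewrite <- (Ropp_involutive y). apply Hp. lra.
Qed.

(** * Alternating tilings of the unit interval by nodal arcs *)

Definition rate (z : R * R) (s : bool) : R := if s then fst z else snd z.
Definition signed (s : bool) (t : R) : R := if s then t else - t.

Fixpoint tiling (len : bool -> R) (s : bool) (n : nat) : R :=
  match n with
  | O => 0
  | S m => len s + tiling len (negb s) m
  end.

Definition tile (z : R * R) (s : bool) : R := 2 / rate z s.

(* [n] alternating nodal arcs, the first one of sign [s], cover the unit
   interval when an arc of sign [s] may have any length between [tile z s] and
   [r * tile z s]. The rate of an absent sign is unconstrained. *)
Definition tiled (r : R) (z : R * R) : Prop :=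
  exists s n, (1 <= n)%nat /\ 0 < rate z s /\
    ((2 <= n)%nat -> 0 < rate z (negb s)) /\
    tiling (tile z) s n <= 1 <= r * tiling (tile z) s n.

Definition nodal_arc (u : R -> R) (s : bool) (c d : R) : Prop :=
  0 <= c /\ c < d /\ d <= 1 /\ u c = 0 /\ u d = 0 /\
  forall y, c < y < d -> 0 < signed s (u y).

Lemma signed_cont (u : R -> R) (s : bool) (x : R) :
  continuous u x -> continuous (fun y => signed s (u y)) x.
Proof.
  intros H. destruct s; [exact H | apply (continuous_opp u x H)].
Qed.

Lemma signed_0 (s : bool) (t : R) : signed s t = 0 <-> t = 0.
Proof. destruct s; simpl; lra. Qed.

Lemma signed_negb (s : bool) (t : R) : signed (negb s) t = - signed s t.
Proof. destruct s; simpl; lra. Qed.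

Lemma nodal_arc_at (u : R -> R) (s : bool) (x : R) :
  (forall x, continuous u x) -> u 0 = 0 -> u 1 = 0 ->
  0 < x < 1 -> 0 < signed s (u x) ->
  exists c d, c < x < d /\ nodal_arc u s c d.
Proof.
  intros Hc H0 H1 Hx Hs.
  assert (Hv := fun y => signed_cont u s y (Hc y)).
  destruct (first_zero _ x 1 Hv) as [d [Hd [Hd0 Hdp]]]; try tauto.
  { rewrite H1. destruct s; simpl; lra. }
  destruct (last_zero _ 0 x Hv) as [c [Hcc [Hc0 Hcp]]]; try tauto.
  { rewrite H0. destruct s; simpl; lra. }
  exists c, d. split; [lra |].
  apply signed_0 in Hd0. apply signed_0 in Hc0.
  repeat split; try lra.
  intros y Hy. destruct (Rle_dec y x); [apply Hcp | apply Hdp]; lra.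
Qed.

(** A lower bound common to both signs makes the enumeration of arcs finite. The constant bounds
    [2 / rate z s] from below whichever rate occurs. *)
Lemma arc_length_bound (z : R * R) (u : R -> R) :
  (forall s c d, nodal_arc u s c d -> 0 < rate z s /\ tile z s <= d - c) ->
  exists delta, 0 < delta /\ forall s c d, nodal_arc u s c d -> delta <= d - c.
Proof.
  intros H. exists (2 / (1 + Rabs (fst z) + Rabs (snd z))).
  assert (A := Rabs_pos (fst z)). assert (B := Rabs_pos (snd z)).
  assert (A' := Rle_abs (fst z)). assert (B' := Rle_abs (snd z)).
  split.
  - apply Rdiv_lt_0_compat; lra.
  - intros s c d Hs. destruct (H s c d Hs) as [Hr Hl].
    apply Rle_trans with (2 := Hl). unfold tile, Rdiv.
    apply Rmult_le_compat_l; [lra |]. apply Rinv_le_contravar; [exact Hr |].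
    destruct s; simpl; lra.
Qed.

(** Opposite values occur arbitrarily close to the right of [d], but the arc through such a point
    could begin beyond [d]. The gap would then contain yet another arc of the opposite sign, and it
    is too short for that. *)
Lemma next_arc (u : R -> R) (delta : R) (s : bool) (c d : R) :
  (forall x, continuous u x) -> u 0 = 0 -> u 1 = 0 ->
  0 < delta -> (forall s c d, nodal_arc u s c d -> delta <= d - c) ->
  nodal_arc u s c d -> d < 1 ->
  (forall e, 0 < e -> exists y, d < y < d + e /\ signed s (u y) < 0) ->
  exists d', nodal_arc u (negb s) d d'.
Proof.
  intros Hc H0 H1 Hdel Hlen Harc Hd1 Hneg.
  destruct Harc as [A1 [A2 [A3 [A4 [A5 A6]]]]].
  assert (Aux : forall e, 0 < e -> d + e <= 1 ->
    exists y c' d', d < y < d + e /\ d <= c' /\ c' < y < d' /\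
                    nodal_arc u (negb s) c' d').
  { intros e He He1. destruct (Hneg e He) as [y [Hy Hy']].
    destruct (nodal_arc_at u (negb s) y) as [c' [d' [Hcd Hn]]]; try assumption.
    - lra.
    - rewrite signed_negb. lra.
    - exists y, c', d'. repeat split; try lra; try apply Hn.
      apply Rnot_lt_le. intros L.
      assert (P := proj2 (proj2 (proj2 (proj2 (proj2 Hn)))) d ltac:(lra)).
      rewrite A5 in P. destruct s; simpl in P; lra. }
  (* Choosing [y] within [delta] of [d] makes any gap between [d] and [c'] shorter than [delta]. *)
  destruct (Aux (Rmin delta (1 - d))) as [y [c' [d' [Hy [Hc' [Hcd Hn]]]]]].
  { unfold Rmin; destruct Rle_dec; lra. }
  { unfold Rmin; destruct Rle_dec; lra. }
  assert (Hyd : y < d + delta) by (unfold Rmin in Hy; destruct Rle_dec; lra).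
  destruct (Req_dec c' d) as [E | E].
  { exists d'. now rewrite <- E. }
  exfalso.
  destruct (Aux (c' - d)) as [y2 [c2 [d2 [Hy2 [Hc2 [Hcd2 Hn2]]]]]]; try lra.
  { destruct Hn as [_ [? [? _]]]. lra. }
  assert (L := Hlen _ _ _ Hn2).
  assert (Hd2 : d2 <= c'); [| lra].
  apply Rnot_lt_le. intros L'.
  assert (P := proj2 (proj2 (proj2 (proj2 (proj2 Hn2)))) c' ltac:(lra)).
  destruct Hn as [_ [_ [_ [E' _]]]]. rewrite E' in P.
  destruct s; simpl in P; lra.
Qed.

(** Arcs are collected from left to right, and the length bounds add up. The number [N] serves as
    induction measure: each new arc uses up at least [delta] of what remains to the right of [d]. *)
Lemma tiling_from_arc (r delta : R) (z : R * R) (u : R -> R) :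
  (forall x, continuous u x) -> u 0 = 0 -> u 1 = 0 ->
  0 < delta ->
  (forall s c d, nodal_arc u s c d ->
     0 < rate z s /\ delta <= d - c /\
     tile z s <= d - c <= r * tile z s) ->
  (forall s c d, nodal_arc u s c d -> d < 1 ->
     forall e, 0 < e -> exists y, d < y < d + e /\ signed s (u y) < 0) ->
  forall N s c d, nodal_arc u s c d -> 1 - d <= INR N * delta ->
  exists n, (1 <= n)%nat /\ ((2 <= n)%nat -> 0 < rate z (negb s)) /\
    tiling (tile z) s n <= 1 - c <= r * tiling (tile z) s n.
Proof.
  intros Hc H0 H1 Hdel Hlen Halt N.
  assert (Hlast : forall s c d, nodal_arc u s c d -> d = 1 ->
    exists n, (1 <= n)%nat /\ ((2 <= n)%nat -> 0 < rate z (negb s)) /\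
    tiling (tile z) s n <= 1 - c <= r * tiling (tile z) s n).
  { intros s c d Ha E. exists 1%nat. split; [lia |]. split; [lia |].
    destruct (Hlen _ _ _ Ha) as [_ [_ ?]]. simpl. rewrite Rplus_0_r. lra. }
  induction N as [| N IH]; intros s c d Ha Hd.
  - apply (Hlast s c d Ha). destruct Ha as [_ [_ [? _]]]. simpl in Hd. lra.
  - destruct (Req_dec d 1) as [E | E]; [now apply (Hlast s c d) |].
    assert (Hd1 : d < 1) by (destruct Ha as [_ [_ [? _]]]; lra).
    destruct (next_arc u delta s c d) as [d' Hn]; try assumption.
    { intros s' c' d' H. apply (Hlen s' c' d' H). }
    { now apply (Halt s c d). }
    destruct (Hlen _ _ _ Hn) as [Hrn [Hdn Htn]].
    destruct (IH _ _ _ Hn) as [n [Hn1 [Hn2 Hn3]]].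
    { rewrite S_INR in Hd. lra. }
    exists (S n). split; [lia |]. split; [intros _; exact Hrn |].
    destruct (Hlen _ _ _ Ha) as [_ [_ Hta]]. simpl.
    rewrite Rmult_plus_distr_l. lra.
Qed.

(* A class of functions stable under [u -> - u] (which exchanges the two rates)
   and under reflection of the interval only has to be examined on the left
   half of positive arcs. *)
Lemma tiled_of_symmetric_class (r : R) (P : R * R -> (R -> R) -> Prop) :
  (forall z u, P z u -> (forall x, continuous u x) /\ u 0 = 0 /\ u 1 = 0) ->
  (forall a b u, P (a, b) u -> P (b, a) (fun x => - u x)) ->
  (forall z u, P z u -> P z (fun x => u (1 - x))) ->
  (forall z u c d m, P z u -> nodal_arc u true c d -> c < m < d ->
     (forall y, c <= y <= d -> u y <= u m) ->
     0 < fst z /\ 1 <= fst z * (m - c) <= r /\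
     (0 < c -> forall e, 0 < e -> exists y, c - e < y < c /\ u y < 0)) ->
  forall z u, P z u -> nontrivial u -> tiled r z.
Proof.
  intros Hcont Hflip Hrefl Hcore.
  assert (Harc : forall z u c d, P z u -> nodal_arc u true c d ->
    0 < fst z /\ 2 / fst z <= d - c <= r * (2 / fst z) /\
    (0 < c -> forall e, 0 < e -> exists y, c - e < y < c /\ u y < 0)).
  { intros z u c d HP Ha.
    assert (Ha' := Ha). destruct Ha' as [A1 [A2 [A3 [A4 [A5 A6]]]]].
    destruct (continuity_ab_maj u c d) as [m [Hm Hcm]].
    - lra.
    - intros x _. apply continuity_pt_filterlim. now apply (Hcont z u).
    - assert (Hmp : 0 < u m).
      { assert (X := Hm ((c + d) / 2) ltac:(lra)).
        assert (Y := A6 ((c + d) / 2) ltac:(lra)). simpl in Y. lra. }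
      assert (Hcm' : c < m < d).
      { destruct (Req_dec c m) as [E | E]; [rewrite <- E in Hmp; lra |].
        destruct (Req_dec d m) as [E' | E']; [rewrite <- E' in Hmp; lra |]. lra. }
      destruct (Hcore z u c d m HP Ha Hcm' Hm) as [Q1 [Q2 Q3]].
      (* The right half of the arc is the left half of its mirror image, which attains its maximum
         at [1 - m]. *)
      destruct (Hcore z (fun x => u (1 - x)) (1 - d) (1 - c) (1 - m)) as [_ [Q2' _]].
      + now apply Hrefl.
      + repeat split; try lra; simpl.
        * now replace (1 - (1 - d)) with d by lra.
        * now replace (1 - (1 - c)) with c by lra.
        * intros y Hy. apply (A6 (1 - y)). lra.
      + lra.
      + intros y Hy. replace (1 - (1 - m)) with m by lra. apply Hm. lra.
      + split; [exact Q1 |]. split; [| exact Q3].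
        replace (1 - m - (1 - d)) with (d - m) in Q2' by lra.
        assert (E : fst z * (d - c) = fst z * (m - c) + fst z * (d - m)) by ring.
        split.
        * apply Rmult_le_reg_l with (1 := Q1). unfold Rdiv.
          rewrite (Rmult_comm 2), <- Rmult_assoc, Rinv_r; lra.
        * apply Rmult_le_reg_l with (1 := Q1). unfold Rdiv.
          replace (fst z * (r * (2 * / fst z))) with (r * 2) by (field; lra). lra. }
  assert (Hsgn : forall z u s, P z u ->
    P (rate z s, rate z (negb s)) (fun x => signed s (u x))).
  { intros [a b] u [|] HP; [exact HP | now apply Hflip]. }
  assert (Hleft : forall z u s c d, P z u -> nodal_arc u s c d ->
    0 < rate z s /\ tile z s <= d - c <= r * tile z s /\
    (0 < c -> forall e, 0 < e -> exists y, c - e < y < c /\ signed s (u y) < 0)).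
  { intros z u s c d HP [A1 [A2 [A3 [A4 [A5 A6]]]]].
    apply (Harc _ _ c d (Hsgn z u s HP)).
    repeat split; try assumption; now apply signed_0. }
  assert (Hmirror : forall u s c d, nodal_arc u s c d ->
    nodal_arc (fun x => u (1 - x)) s (1 - d) (1 - c)).
  { intros u s c d [A1 [A2 [A3 [A4 [A5 A6]]]]]. repeat split; try lra; simpl.
    - now replace (1 - (1 - d)) with d by lra.
    - now replace (1 - (1 - c)) with c by lra.
    - intros y Hy. apply (A6 (1 - y)). lra. }
  assert (Hmirror' : forall u s c d, nodal_arc (fun x => u (1 - x)) s c d ->
    nodal_arc u s (1 - d) (1 - c)).
  { intros u s c d [A1 [A2 [A3 [A4 [A5 A6]]]]]. repeat split; try lra.
    intros y Hy. replace y with (1 - (1 - y)) by lra. apply A6. lra. }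
  (* The sign change at the right end is the one at the left end of the mirrored arc. *)
  assert (Hright : forall z u s c d, P z u -> nodal_arc u s c d -> d < 1 ->
    forall e, 0 < e -> exists y, d < y < d + e /\ signed s (u y) < 0).
  { intros z u s c d HP Ha Hd e He.
    destruct (proj2 (proj2 (Hleft _ _ _ _ _ (Hrefl z u HP) (Hmirror _ _ _ _ Ha)))
                ltac:(lra) e He) as [y [Hy Hy']].
    exists (1 - y). split; [lra | exact Hy']. }
  intros z u HP [x [Hx Hux]].
  destruct (Hcont z u HP) as [Hc [H0 H1]].
  destruct (arc_length_bound z u) as [delta [Hdel Hlen]].
  { intros s c d Ha. destruct (Hleft z u s c d HP Ha) as [? [? _]]. lra. }
  assert (Hlen' : forall s c d, nodal_arc u s c d ->
     0 < rate z s /\ delta <= d - c /\ tile z s <= d - c <= r * tile z s).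
  { intros s c d Ha. assert (X := Hlen s c d Ha).
    destruct (Hleft z u s c d HP Ha) as [? [? _]]. lra. }
  (* Starting from any arc, a walk to the left, that is, [next_arc] applied to the reflected
     function, reaches an arc beginning at 0 after at most [N] steps. *)
  assert (Hstart : forall N s c d, nodal_arc u s c d -> c <= INR N * delta ->
    exists s' d', nodal_arc u s' 0 d').
  { induction N as [| N IH]; intros s c d Ha HcN.
    - exists s, d. replace 0 with c; [exact Ha |].
      destruct Ha as [? _]. simpl in HcN. lra.
    - destruct (Req_dec c 0) as [E | E].
      { exists s, d. now rewrite <- E. }
      assert (Hc0 : 0 < c) by (destruct Ha as [? _]; lra).
      destruct (next_arc (fun x => u (1 - x)) delta s (1 - d) (1 - c)) as [d' Hn].
      + now apply continuous_reflect.
      + now rewrite Rminus_0_r.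
      + now rewrite Rminus_diag.
      + exact Hdel.
      + intros s' c' d' Ha'. replace (d' - c') with (1 - c' - (1 - d')) by lra.
        now apply (Hlen s'), Hmirror'.
      + now apply Hmirror.
      + lra.
      + apply (Hright z (fun x => u (1 - x)) s (1 - d) (1 - c)).
        * now apply Hrefl.
        * now apply Hmirror.
        * lra.
      + assert (Ha' := Hmirror' _ _ _ _ Hn).
        replace (1 - (1 - c)) with c in Ha' by lra.
        apply (IH _ _ _ Ha'). assert (L := Hlen _ _ _ Ha').
        rewrite S_INR in HcN. lra. }
  assert (Hx' : exists s, 0 < signed s (u x)).
  { destruct (Rlt_dec 0 (u x)); [now exists true | exists false; simpl; lra]. }
  destruct Hx' as [s0 Hs0].
  destruct (nodal_arc_at u s0 x) as [c [d [_ Ha]]]; try assumption.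
  destruct (INR_unbounded (1 / delta)) as [N HN].
  assert (HN' : 1 <= INR N * delta).
  { apply Rmult_le_reg_r with (/ delta); [now apply Rinv_0_lt_compat |].
    rewrite Rmult_assoc, Rinv_r; lra. }
  destruct (Hstart N s0 c d Ha) as [s [d0 Ha0]].
  { destruct Ha as [? [? [? _]]]. lra. }
  destruct (tiling_from_arc r delta z u Hc H0 H1 Hdel Hlen'
              (fun s c d => Hright z u s c d HP) N s 0 d0 Ha0) as [n [N1 [N2 N3]]].
  { destruct Ha0 as [? [? [? _]]]. lra. }
  exists s, n. rewrite Rminus_0_r in N3. repeat split; try assumption; try apply N3.
  apply (Hlen' s 0 d0 Ha0).
Qed.

(** * Solutions of the limit problem *)

(** Precomposition with this retraction extends a function on the closed interval by constants, so
    that continuity holds on the whole line, as the lemmas on arcs require. Near points of [Omega]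
    nothing changes. *)
Definition clamp (x : R) : R := Rmax 0 (Rmin 1 x).

Lemma clamp_id (x : R) : 0 <= x <= 1 -> clamp x = x.
Proof.
  intros H. unfold clamp. rewrite (Rmin_right 1 x), Rmax_right; lra.
Qed.

Lemma clamp_cont_extension (u : R -> R) :
  continuous_on Omega_closure u -> forall x, continuous (fun y => u (clamp y)) x.
Proof.
  intros Hu x.
  assert (B : forall y, 0 <= clamp y <= 1).
  { intros y. unfold clamp, Rmax, Rmin. repeat destruct Rle_dec; lra. }
  assert (L : forall y, Rabs (clamp y - clamp x) <= Rabs (y - x)).
  { intros y. unfold clamp, Rmax, Rmin, Rabs.
    repeat destruct Rle_dec; repeat destruct Rcase_abs; lra. }
  intros Q HQ. specialize (Hu (clamp x) (B x) Q HQ).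
  apply locally_R in Hu. destruct Hu as [e [He Hu]].
  apply locally_R. exists e. split; [exact He |].
  intros y Hy. apply Hu; [| apply B]. specialize (L y). lra.
Qed.

Lemma clamp_locally (u : R -> R) (x : R) :
  Omega x -> locally x (fun y => u y = u (clamp y)).
Proof.
  intros Hx. apply (locally_interval _ x 0 1); try (simpl; unfold Omega in Hx; lra).
  simpl. intros y H0 H1. rewrite clamp_id; [reflexivity | lra].
Qed.

Lemma clamp_dirichlet (u : R -> R) :
  continuous_dirichlet u ->
  (forall x, continuous (fun y => u (clamp y)) x) /\
  u (clamp 0) = 0 /\ u (clamp 1) = 0.
Proof.
  intros [Hc [H0 H1]]. split; [now apply clamp_cont_extension |].
  rewrite !clamp_id; lra.
Qed.

Definition infty_fucik_at (z : R * R) (u : R -> R) (x0 : R) : Prop :=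
  (0 < u x0 ->
     viscosity_at (fun phi x => Rmin (- infty_laplacian phi x)
                      (Rabs (Derive phi x) - fst z * pos_part (u x))) u x0) /\
  (u x0 < 0 ->
     viscosity_at (fun phi x => Rmax (- infty_laplacian phi x)
                      (- Rabs (Derive phi x) + snd z * neg_part (u x))) u x0) /\
  (u x0 = 0 ->
     viscosity_at (fun phi x => - infty_laplacian phi x) u x0).

Lemma C2_opp (phi : R -> R) :
  C2_on_Omega phi -> C2_on_Omega (fun x => - phi x).
Proof.
  intros H x Hx. destruct (H x Hx) as [H1 [H2 H3]].
  assert (E : forall y, - Derive phi y = Derive (fun t => - phi t) y).
  { intros y. symmetry. apply Derive_opp. }
  repeat split.
  - now apply (ex_derive_opp phi).
  - apply (ex_derive_ext _ _ _ E). now apply (ex_derive_opp (Derive phi)).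
  - apply (continuous_ext (fun y => - Derive_n phi 2 y)).
    + intros y. symmetry. apply Derive_n_opp.
    + now apply (continuous_opp (Derive_n phi 2)).
Qed.

Lemma infty_laplacian_opp (phi : R -> R) (x : R) :
  infty_laplacian (fun y => - phi y) x = - infty_laplacian phi x.
Proof.
  unfold infty_laplacian. rewrite Derive_opp, Derive_n_opp. ring.
Qed.

Lemma viscosity_opp (F G : (R -> R) -> R -> R) (u : R -> R) (x0 : R) :
  (forall phi, G (fun y => - phi y) x0 = - F phi x0) ->
  viscosity_at G u x0 -> viscosity_at F (fun y => - u y) x0.
Proof.
  intros E [Hsub Hsup]. split; intros phi Hphi Hloc.
  - assert (X := Hsup _ (C2_opp phi Hphi)). rewrite E in X.
    enough (0 <= - F phi x0) by lra. apply X.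
    revert Hloc. apply filter_imp. intros y. lra.
  - assert (X := Hsub _ (C2_opp phi Hphi)). rewrite E in X.
    enough (- F phi x0 <= 0) by lra. apply X.
    revert Hloc. apply filter_imp. intros y. lra.
Qed.

Lemma infty_fucik_at_opp (a b : R) (u : R -> R) (x0 : R) :
  infty_fucik_at (a, b) u x0 -> infty_fucik_at (b, a) (fun y => - u y) x0.
Proof.
  intros [H1 [H2 H3]]. split; [| split]; intros H; simpl in *.
  - eapply viscosity_opp; [| apply H2; lra]. intros phi. cbv beta.
    rewrite infty_laplacian_opp, Derive_opp, Rabs_Ropp.
    unfold neg_part, pos_part, Rmin, Rmax. repeat destruct Rle_dec; lra.
  - eapply viscosity_opp; [| apply H1; lra]. intros phi. cbv beta.
    rewrite infty_laplacian_opp, Derive_opp, Rabs_Ropp, Ropp_involutive.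
    unfold neg_part, pos_part. rewrite Ropp_involutive.
    unfold Rmin, Rmax. repeat destruct Rle_dec; lra.
  - eapply viscosity_opp; [| apply H3; lra]. intros phi. cbv beta.
    now rewrite infty_laplacian_opp.
Qed.

(* [F B D] is the value of the operator on a test function with slope [B] and
   second derivative [D]; parabolas suffice for the necessary conditions. *)
Definition quad_below (F : R -> R -> R) (u : R -> R) (x0 : R) : Prop :=
  forall B C,
    locally x0 (fun y => u x0 + B * (y - x0) + C * (y - x0) ^ 2 <= u y) ->
    0 <= F B (2 * C).

Definition quad_above (F : R -> R -> R) (u : R -> R) (x0 : R) : Prop :=
  forall B C,
    locally x0 (fun y => u y <= u x0 + B * (y - x0) + C * (y - x0) ^ 2) ->
    F B (2 * C) <= 0.

Definition quad_at (F : R -> R -> R) (u : R -> R) (x0 : R) : Prop :=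
  quad_above F u x0 /\ quad_below F u x0.

Definition infty_op (B D : R) : R := - (B * D * B).
Definition infty_rate_op (a t B D : R) : R := Rmin (- (B * D * B)) (Rabs B - a * t).

(** Where [u] is negative, the condition is put on [- u] with the operator of the positive case, so
    that the two signs are exchanged by negation and only positive arcs have to be studied. *)
Definition quad_fucik (z : R * R) (u : R -> R) : Prop :=
  ((forall x, continuous u x) /\ u 0 = 0 /\ u 1 = 0) /\
  forall x0, Omega x0 ->
    (0 < u x0 -> quad_at (infty_rate_op (fst z) (u x0)) u x0) /\
    (u x0 < 0 -> quad_at (infty_rate_op (snd z) (- u x0)) (fun y => - u y) x0) /\
    (u x0 = 0 -> quad_at infty_op u x0).

Lemma quad_at_of_viscosity (F : (R -> R) -> R -> R) (G : R -> R -> R)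
  (u : R -> R) (x0 : R) :
  (forall phi, F phi x0 = G (Derive phi x0) (Derive_n phi 2 x0)) ->
  viscosity_at F u x0 -> quad_at G u x0.
Proof.
  intros E [Hsub Hsup].
  assert (D1 : forall B C y,
    is_derive (fun t => u x0 + B * (t - x0) + C * (t - x0) ^ 2) y
      (B + 2 * C * (y - x0))).
  { intros B C y. auto_derive; [trivial | ring]. }
  assert (D2 : forall B C y,
    is_derive (fun t => B + 2 * C * (t - x0)) y (2 * C)).
  { intros B C y. auto_derive; [trivial | ring]. }
  assert (E2 : forall B C y, Derive_n
    (fun t => u x0 + B * (t - x0) + C * (t - x0) ^ 2) 2 y = 2 * C).
  { intros B C y. simpl.
    rewrite (Derive_ext _ (fun t => B + 2 * C * (t - x0))).
    - apply is_derive_unique, D2.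
    - intros t. apply is_derive_unique, D1. }
  assert (Hq : forall B C, C2_on_Omega
    (fun t => u x0 + B * (t - x0) + C * (t - x0) ^ 2)).
  { intros B C x Hx. repeat split.
    - eexists. apply D1.
    - apply (ex_derive_ext (fun t => B + 2 * C * (t - x0))).
      + intros t. symmetry. apply is_derive_unique, D1.
      + eexists. apply D2.
    - apply (continuous_ext (fun _ => 2 * C)).
      + intros y. symmetry. apply E2.
      + apply continuous_const. }
  assert (V : forall B C, F (fun t => u x0 + B * (t - x0) + C * (t - x0) ^ 2) x0
                          = G B (2 * C)).
  { intros B C. rewrite E, E2. f_equal.
    transitivity (B + 2 * C * (x0 - x0)); [apply is_derive_unique, D1 | ring]. }
  split; intros B C Hloc; rewrite <- V; [apply Hsub | apply Hsup]; try apply Hq;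
    revert Hloc; apply filter_imp; intros y Hy; cbv beta;
    rewrite Rminus_diag; lra.
Qed.

Lemma quad_fucik_of_infty (z : R * R) (u : R -> R) :
  infty_fucik_solution (fst z) (snd z) u -> quad_fucik z (fun x => u (clamp x)).
Proof.
  intros [Hd H].
  split; [now apply clamp_dirichlet |].
  intros x0 Hx. assert (E : clamp x0 = x0).
  { apply clamp_id. unfold Omega in Hx. lra. }
  assert (T : forall v G, (forall y, v y = u y) \/ (forall y, v y = - u y) ->
    quad_at G v x0 -> quad_at G (fun y => v (clamp y)) x0).
  { intros v G Hv [Q1 Q2].
    assert (L := clamp_locally v x0 Hx).
    split; intros B C HB; [apply Q1 | apply Q2];
      generalize (filter_and _ _ HB L); apply filter_imp; rewrite E;
      intros y [Hy1 Hy2]; lra. }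
  assert (Hat : infty_fucik_at z u x0) by exact (H x0 Hx).
  rewrite E. split; [| split]; intros Hs.
  - apply T; [now left |].
    eapply quad_at_of_viscosity; [| apply (proj1 Hat Hs)].
    intros phi. cbv beta. unfold infty_rate_op, infty_laplacian, pos_part.
    now rewrite (Rmax_right 0 (u x0) ltac:(lra)).
  - apply (T (fun y => - u y)); [now right |].
    destruct z as [a b]. apply infty_fucik_at_opp in Hat.
    eapply quad_at_of_viscosity; [| apply (proj1 Hat); lra].
    intros phi. cbv beta. unfold infty_rate_op, infty_laplacian, pos_part.
    now rewrite (Rmax_right 0 (- u x0) ltac:(lra)).
  - apply T; [now left |].
    eapply quad_at_of_viscosity; [| apply (proj2 (proj2 Hat) Hs)].
    reflexivity.
Qed.

Lemma quad_fucik_opp (a b : R) (u : R -> R) :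
  quad_fucik (a, b) u -> quad_fucik (b, a) (fun x => - u x).
Proof.
  intros [[Hc [H0 H1]] H]. split; [repeat split |].
  - intros x. apply (continuous_opp u x (Hc x)).
  - lra.
  - lra.
  - intros x0 Hx. destruct (H x0 Hx) as [P1 [P2 P3]]. simpl in *.
    split; [| split]; intros Hs.
    + apply P2. lra.
    + rewrite Ropp_involutive. destruct P1 as [Q1 Q2]; [lra |].
      split; intros B C HB; [apply Q1 | apply Q2]; revert HB; apply filter_imp;
        intros y; lra.
    + destruct P3 as [Q1 Q2]; [lra |]. unfold infty_op in *.
      split; intros B C HB.
      * enough (0 <= - (- B * (2 * - C) * - B)) by lra.
        apply Q2. revert HB. apply filter_imp. intros y. lra.
      * enough (- (- B * (2 * - C) * - B) <= 0) by lra.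
        apply Q1. revert HB. apply filter_imp. intros y. lra.
Qed.

Lemma locally_reflect (P : R -> Prop) (x : R) :
  locally (1 - x) P -> locally x (fun y => P (1 - y)).
Proof.
  intros H. apply locally_R in H. destruct H as [e [He H]].
  apply locally_R. exists e. split; [exact He |].
  intros y Hy. apply H. replace (1 - y - (1 - x)) with (- (y - x)) by ring.
  now rewrite Rabs_Ropp.
Qed.

(** Reflection reverses the slope of a touching parabola and keeps its second derivative, so an
    operator even in the slope is preserved. *)
Lemma quad_at_reflect (G : R -> R -> R) (u : R -> R) (x0 : R) :
  (forall B D, G (- B) D = G B D) ->
  quad_at G u (1 - x0) -> quad_at G (fun y => u (1 - y)) x0.
Proof.
  intros HG [Q1 Q2].
  assert (E : forall y, 1 - (1 - y) = y) by (intros y; ring).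
  split; intros B C HB; rewrite <- HG; [apply Q1 | apply Q2];
    rewrite <- (E x0) in HB; apply locally_reflect in HB; revert HB;
    apply filter_imp; intros y; rewrite !E; nra.
Qed.

Lemma quad_fucik_reflect (z : R * R) (u : R -> R) :
  quad_fucik z u -> quad_fucik z (fun x => u (1 - x)).
Proof.
  intros [[Hc [H0 H1]] H]. split; [repeat split |].
  - now apply continuous_reflect.
  - now rewrite Rminus_0_r.
  - now rewrite Rminus_diag.
  - intros x0 Hx. destruct (H (1 - x0)) as [P1 [P2 P3]].
    { unfold Omega in *. lra. }
    assert (G1 : forall a t B D, infty_rate_op a t (- B) D = infty_rate_op a t B D).
    { intros a t B D. unfold infty_rate_op. rewrite Rabs_Ropp. f_equal. ring. }
    assert (G2 : forall B D, infty_op (- B) D = infty_op B D).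
    { intros B D. unfold infty_op. ring. }
    split; [| split]; intros Hs.
    + apply quad_at_reflect; [apply G1 | now apply P1].
    + apply (quad_at_reflect _ (fun y => - u y)); [apply G1 | now apply P2].
    + apply quad_at_reflect; [apply G2 | now apply P3].
Qed.

(** * Touching by parabolas: concavity and length of the arcs of the limit problem *)

Lemma argmin_interior (g : R -> R) (a b y : R) :
  (forall x, continuous g x) -> a < y < b -> g y < g a -> g y < g b ->
  exists t, a < t < b /\ g t <= g y /\ forall x, a < x < b -> g t <= g x.
Proof.
  intros Hc Hy Ha Hb.
  destruct (continuity_ab_min g a b) as [t [Ht Hab]].
  - lra.
  - intros c _. apply continuity_pt_filterlim, Hc.
  - assert (g t <= g y) by (apply Ht; lra).
    assert (t <> a) by (intros ->; lra).
    assert (t <> b) by (intros ->; lra).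
    exists t. split; [lra |]. split; [assumption |]. intros x Hx. apply Ht. lra.
Qed.

Lemma locally_open_interval (a b x : R) (P : R -> Prop) :
  a < x < b -> (forall y, a < y < b -> P y) -> locally x P.
Proof.
  intros Hx H. apply (locally_interval P x a b); simpl; try lra.
  intros y Ha Hb. apply H. lra.
Qed.

Lemma continuous_add_derivable (u f : R -> R) :
  (forall x, continuous u x) -> (forall x, ex_derive f x) ->
  forall x, continuous (fun t => u t - f t) x.
Proof.
  intros Hu Hf x. apply (continuous_minus u f); [apply Hu |].
  now apply (ex_derive_continuous f).
Qed.

(** If [u] dipped below the line at [y], the line bent by the small convex term [e (t - x) (t - w)]
    would, after a vertical shift, touch [u] from below at an interior point, with positive second
    derivative. Its slope is still nonzero there, so [- B * D * B] is negative, which a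
    supersolution forbids. *)
Lemma above_sloped_line (a : R) (u : R -> R) (x y w A s : R) :
  (forall x, continuous u x) ->
  (forall t, x < t < w -> quad_below (infty_rate_op a (u t)) u t) ->
  x < y < w -> s <> 0 -> A + s * (x - y) <= u x -> A + s * (w - y) <= u w ->
  A <= u y.
Proof.
  intros Hc Hq Hy Hs Hx Hw. apply Rnot_lt_le. intros L.
  assert (Sp := Rabs_pos_lt s Hs).
  (* The first bound keeps the slope of the bent line away from 0 on the whole interval; the second
     keeps [u] strictly below the bent line at [y]. *)
  set (e := Rmin (Rabs s / (2 * (w - x))) ((A - u y) / (2 * ((y - x) * (w - y))))).
  assert (P1 : 0 < (y - x) * (w - y)) by nra.
  assert (He : 0 < e).
  { apply Rmin_glb_lt; apply Rdiv_lt_0_compat; lra. }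
  assert (He1 : e * (w - x) < Rabs s).
  { apply Rle_lt_trans with (Rabs s / (2 * (w - x)) * (w - x)).
    - apply Rmult_le_compat_r; [lra | apply Rmin_l].
    - replace (Rabs s / (2 * (w - x)) * (w - x)) with (Rabs s / 2) by (field; lra).
      lra. }
  assert (He2 : e * ((y - x) * (w - y)) < A - u y).
  { apply Rle_lt_trans with
      ((A - u y) / (2 * ((y - x) * (w - y))) * ((y - x) * (w - y))).
    - apply Rmult_le_compat_r; [lra | apply Rmin_r].
    - replace ((A - u y) / (2 * ((y - x) * (w - y))) * ((y - x) * (w - y)))
        with ((A - u y) / 2) by (field; split; lra). lra. }
  destruct (argmin_interior
    (fun t => u t - (A + s * (t - y) + e * ((t - x) * (t - w)))) x w y)
    as [t [Ht [_ Hmin]]].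
  - apply continuous_add_derivable; [exact Hc |]. intros t. auto_derive. trivial.
  - exact Hy.
  - nra.
  - nra.
  - set (B := s + e * (2 * t - x - w)).
    assert (HB : B <> 0).
    { unfold B. intros E. apply (Rlt_irrefl (Rabs s)).
      apply Rle_lt_trans with (2 := He1).
      replace s with (- (e * (2 * t - x - w))) by lra.
      rewrite Rabs_Ropp, Rabs_mult, (Rabs_pos_eq e) by lra.
      apply Rmult_le_compat_l; [lra |]. apply Rabs_le. lra. }
    assert (X : 0 <= infty_rate_op a (u t) B (2 * e)).
    { apply (Hq t Ht). apply (locally_open_interval x w); [exact Ht |].
      intros v Hv. specialize (Hmin v Hv). unfold B. cbv beta in Hmin. nra. }
    unfold infty_rate_op in X.
    assert (Y := Rmin_l (- (B * (2 * e) * B)) (Rabs B - a * u t)).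
    assert (0 < B * B) by (apply Rsqr_pos_lt in HB; exact HB). nra.
Qed.

(** Concavity means lying above chords, and the previous lemma covers chords of nonzero slope. A
    horizontal chord, where the operator degenerates, is tilted first. *)
Lemma concave_of_quad_below (a : R) (u : R -> R) (c d x y w : R) :
  (forall x, continuous u x) ->
  (forall t, c < t < d -> quad_below (infty_rate_op a (u t)) u t) ->
  c <= x -> x < y < w -> w <= d ->
  (w - y) * u x + (y - x) * u w <= (w - x) * u y.
Proof.
  intros Hc Hq Hx Hy Hw.
  set (s := (u w - u x) / (w - x)).
  set (A := u x + s * (y - x)).
  assert (Es : s * (w - x) = u w - u x) by (unfold s; field; lra).
  assert (Hq' : forall t, x < t < w -> quad_below (infty_rate_op a (u t)) u t).
  { intros t Ht. apply Hq. lra. }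
  assert (HA : A <= u y).
  { destruct (Req_dec s 0) as [E | E].
    - apply Rnot_lt_le. intros L.
      assert (E1 : u x = A) by (unfold A; rewrite E; ring).
      assert (E2 : u w = A) by (unfold A; rewrite E in *; lra).
      assert (N : (A + u y) / 2 <= u y); [| lra].
      (* The tilted line passes halfway between [u y] and [A] at [y] and through the value [A] at
         [w]; at [x] it lies below [A]. If [u y < A], it has positive slope and would yield a value
         at [y] larger than [u y]. *)
      apply (above_sloped_line a u x y w _ ((A - u y) / (2 * (w - y))));
        try assumption.
      + apply Rgt_not_eq, Rdiv_lt_0_compat; lra.
      + rewrite E1. assert (0 < (A - u y) / (2 * (w - y))) by
          (apply Rdiv_lt_0_compat; lra). nra.
      + rewrite E2. replace ((A - u y) / (2 * (w - y)) * (w - y)) with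
          ((A - u y) / 2) by (field; lra). lra.
    - apply (above_sloped_line a u x y w A s); try assumption.
      + unfold A. lra.
      + unfold A. lra. }
  unfold A in HA.
  replace ((w - y) * u x + (y - x) * u w) with ((w - x) * (u x + s * (y - x))).
  - apply Rmult_le_compat_l; lra.
  - replace (u w) with (u x + s * (w - x)) by lra. ring.
Qed.

Lemma Rle_of_small_slack (x y k e0 : R) :
  0 < e0 -> 0 <= k -> (forall e, 0 < e < e0 -> x <= y + k * e) -> x <= y.
Proof.
  intros He Hk H. apply Rnot_lt_le. intros L.
  set (e := Rmin (e0 / 2) ((x - y) / (2 * (k + 1)))).
  assert (P : 0 < (x - y) / (2 * (k + 1))) by (apply Rdiv_lt_0_compat; lra).
  assert (0 < e < e0) by (unfold e, Rmin; destruct Rle_dec; lra).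
  assert (X := H e ltac:(assumption)).
  assert (k * e <= (k + 1) * ((x - y) / (2 * (k + 1)))).
  { apply Rmult_le_compat; try lra. apply Rmin_r. }
  replace ((k + 1) * ((x - y) / (2 * (k + 1)))) with ((x - y) / 2) in * by (field; lra).
  lra.
Qed.

(* Otherwise a parabola [B (t - c) - K (t - c)^2] with [a M < B < M / (m - c)]
   and small [K] touches [u] from above with slope larger than [a u]. *)
Lemma half_arc_lower (a : R) (u : R -> R) (c d m : R) :
  (forall x, continuous u x) -> c < m < d -> u c = 0 ->
  (forall t, c < t < d -> 0 < u t <= u m) ->
  (forall t, c < t < d -> quad_above (infty_rate_op a (u t)) u t) ->
  1 <= a * (m - c).
Proof.
  intros Hc Hm Hu0 Hu Hq. apply Rnot_lt_le. intros L.
  set (M := u m) in *.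
  assert (HM : 0 < M) by (apply Hu; lra).
  set (h := m - c) in *. assert (Hh : 0 < h) by (unfold h; lra).
  (* The sign of [a] is not known at this stage; the maximum with 0 covers [a <= 0], which is
     thereby excluded as well. *)
  set (b0 := Rmax 0 (a * M)).
  assert (Hb0 : 0 <= b0) by apply Rmax_l.
  assert (Hb1 : b0 < M / h).
  { apply Rmax_lub_lt.
    - now apply Rdiv_lt_0_compat.
    - apply Rmult_lt_reg_r with h; [exact Hh |].
      replace (M / h * h) with M by (field; lra). nra. }
  set (B := (b0 + M / h) / 2).
  assert (HB : b0 < B < M / h) by (unfold B; lra).
  (* With [4 K h = B - b0] the slope [B - 2 K (t - c)] exceeds [b0] up to [m], and the parabola
     increases up to [m + h]. *)
  set (K := (B - b0) / (4 * h)).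
  assert (HK : 0 < K) by (unfold K; apply Rdiv_lt_0_compat; lra).
  assert (EK : 4 * K * h = B - b0) by (unfold K; field; lra).
  assert (HBM : B * h < M).
  { replace M with (M / h * h) by (field; lra). apply Rmult_lt_compat_r; lra. }
  (* The interval extends past [m] to make [m] interior. Beyond [m] the parabola still increases
     while [u] does not exceed [M], so the contact point cannot lie to the right of [m]. *)
  set (e := Rmin ((m + d) / 2) (m + h)).
  assert (He : m < e < d /\ e <= m + h)
    by (unfold e, Rmin; destruct Rle_dec; lra).
  assert (Hinc : forall t, m < t <= e ->
    B * (m - c) - K * (m - c) ^ 2 < B * (t - c) - K * (t - c) ^ 2).
  { intros t Ht.
    assert (0 < (t - m) * (B - K * (t + m - 2 * c))); [| nra].
    apply Rmult_lt_0_compat; [lra |].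
    assert (K * (t + m - 2 * c) <= K * (3 * h)); [| nra].
    apply Rmult_le_compat_l; unfold h in *; lra. }
  destruct (argmin_interior
    (fun t => - u t - - (B * (t - c) - K * (t - c) ^ 2)) c e m)
    as [t [Ht [Htm Hmin]]].
  - apply continuous_add_derivable.
    + intros x. apply (continuous_opp u x (Hc x)).
    + intros t. auto_derive. trivial.
  - lra.
  - fold M h. rewrite Hu0. nra.
  - fold M. assert (X := Hinc e ltac:(lra)). assert (Y := Hu e ltac:(lra)).
    fold M in Y. lra.
  - fold M in Htm.
    assert (Htm' : t <= m).
    { apply Rnot_lt_le. intros L'. assert (X := Hinc t ltac:(lra)).
      assert (Y := Hu t ltac:(lra)). fold M in Y. lra. }
    set (B' := B - 2 * K * (t - c)).
    assert (HB' : b0 < B').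
    { unfold B'. assert (K * (t - c) <= K * h); [| nra].
      apply Rmult_le_compat_l; unfold h; lra. }
    assert (X : infty_rate_op a (u t) B' (2 * - K) <= 0).
    { apply (Hq t); [lra |]. apply (locally_open_interval c e); [exact Ht |].
      intros v Hv. specialize (Hmin v Hv). unfold B'. cbv beta in Hmin. nra. }
    revert X. apply Rlt_not_le. unfold infty_rate_op.
    apply Rmin_glb_lt.
    + assert (0 < B' * B') by nra. nra.
    + rewrite Rabs_pos_eq by lra.
      assert (Y := Hu t ltac:(lra)). fold M in Y.
      assert (Z := Rmax_r 0 (a * M)). fold b0 in Z.
      destruct (Rle_dec 0 a); nra.
Qed.

(* [u] is touched from below near any point left of [m] by a parabola; by
   concavity its slope is at most [u t / (t - c)], and at least [a u t]. *)
Lemma half_arc_upper (a : R) (u : R -> R) (c d m : R) :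
  (forall x, continuous u x) -> c < m < d -> u c = 0 ->
  (forall t, c < t < d -> 0 < u t <= u m) ->
  (forall t, c < t < d -> quad_below (infty_rate_op a (u t)) u t) ->
  a * (m - c) <= 1.
Proof.
  intros Hc Hm Hu0 Hu Hq. apply Rnot_lt_le. intros L.
  set (M := u m) in *.
  assert (HM : 0 < M) by (apply Hu; lra).
  assert (Ha : 0 < a) by nra.
  assert (Hia : a * / a = 1) by (apply Rinv_r; lra).
  assert (Hia0 := Rinv_0_lt_compat a Ha).
  assert (Hlt : c + / a < m) by nra.
  (* The window of radius [rho] around [s] lies strictly between [c + 1/a] and [m]. As
     [K rho^2 = 2 M] exceeds the oscillation of [u], the contact point falls into this window. *)
  set (rho := (m - (c + / a)) / 4). set (s := m - 2 * rho).
  set (K := 2 * M / rho ^ 2).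
  assert (Hrho : 0 < rho) by (unfold rho; lra).
  assert (HK : 0 < K).
  { unfold K. apply Rdiv_lt_0_compat; [lra |]. now apply pow_lt. }
  assert (EK : K * rho ^ 2 = 2 * M) by (unfold K; field; lra).
  assert (Hs : c + / a < s - rho /\ s + rho < m) by (unfold s, rho; lra).
  destruct (argmin_interior (fun t => u t - - (K * (t - s) ^ 2)) (s - rho) (s + rho) s)
    as [t [Ht [_ Hmin]]].
  - apply continuous_add_derivable; [exact Hc |]. intros t. auto_derive. trivial.
  - lra.
  - replace (s - rho - s) with (- rho) by ring. rewrite Rminus_diag.
    assert (X := Hu s ltac:(lra)). assert (Y := Hu (s - rho) ltac:(lra)).
    fold M in X. nra.
  - replace (s + rho - s) with rho by ring. rewrite Rminus_diag.
    assert (X := Hu s ltac:(lra)). assert (Y := Hu (s + rho) ltac:(lra)).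
    fold M in X. nra.
  - set (B := - (2 * K * (t - s))).
    assert (Htouch : forall v, s - rho < v < s + rho ->
      u t + B * (v - t) + - K * (v - t) ^ 2 <= u v).
    { intros v Hv. specialize (Hmin v Hv). unfold B. cbv beta in Hmin. nra. }
    assert (X : 0 <= infty_rate_op a (u t) B (2 * - K)).
    { apply (Hq t); [lra |]. apply (locally_open_interval (s - rho) (s + rho)).
      - exact Ht.
      - exact Htouch. }
    assert (X' : a * u t <= Rabs B).
    { unfold infty_rate_op in X.
      assert (Y := Rmin_r (- (B * (2 * - K) * B)) (Rabs B - a * u t)). lra. }
    assert (Hut := Hu t ltac:(lra)). fold M in Hut.
    (* By concavity [u] does not decrease up to its maximum point [m], so a negative slope would
       contradict the contact to the left of [t], up to the curvature term [K e]. *)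
    assert (HB0 : 0 <= B).
    { apply (Rle_of_small_slack 0 B K (t - (s - rho))); try lra.
      intros e He.
      assert (Y := Htouch (t - e) ltac:(lra)).
      assert (Z := concave_of_quad_below a u c d (t - e) t m Hc Hq
                     ltac:(lra) ltac:(lra) ltac:(lra)).
      fold M in Z. replace (t - e - t) with (- e) in Y by ring.
      replace (t - (t - e)) with e in Z by ring.
      assert (u (t - e) <= u t) by nra. nra. }
    (* By concavity [u] lies to the right of [t] below the line through [(c, 0)] and [(t, u t)]; the
       contact there gives the bound up to a term that vanishes with [e]. *)
    assert (HB1 : (t - c) * B <= u t).
    { apply (Rle_of_small_slack ((t - c) * B) (u t) ((t - c) * K) (s + rho - t));
        try lra.
      { apply Rmult_le_pos; lra. }
      intros e He.
      assert (Y := Htouch (t + e) ltac:(lra)).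
      assert (Z := concave_of_quad_below a u c d c t (t + e) Hc Hq
                     ltac:(lra) ltac:(lra) ltac:(lra)).
      rewrite Hu0 in Z. replace (t + e - t) with e in * by ring.
      assert (Y' : (t - c) * (u t + B * e + - K * e ^ 2) <= (t - c) * u (t + e))
        by (apply Rmult_le_compat_l; lra).
      assert (Y2 : e * ((t - c) * B) <= e * (u t + (t - c) * K * e)) by nra.
      apply Rmult_le_reg_l in Y2; lra. }
    rewrite Rabs_pos_eq in X' by exact HB0.
    assert (1 < a * (t - c)) by nra.
    assert ((t - c) * (a * u t) <= u t).
    { apply Rle_trans with (2 := HB1). apply Rmult_le_compat_l; lra. }
    nra.
Qed.

(* If [u] were nonnegative on the left of the zero [c], then a convex parabola
   through it with half of the slope of the arc would touch [u] from below. *)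
Lemma arc_crosses_zero (a : R) (u : R -> R) (c d m : R) :
  (forall x, continuous u x) -> c < m < d -> u c = 0 -> 0 < u m ->
  (forall t, c < t < d -> quad_below (infty_rate_op a (u t)) u t) ->
  quad_below infty_op u c ->
  forall e, 0 < e -> exists y, c - e < y < c /\ u y < 0.
Proof.
  intros Hc Hm Hu0 Hum Hq Hz e He. apply NNPP. intros N.
  assert (Hpos : forall y, c - e < y < c -> 0 <= u y).
  { intros y Hy. apply Rnot_lt_le. intros L. apply N. now exists y. }
  set (l := u m / (m - c)).
  assert (Hl : 0 < l) by (apply Rdiv_lt_0_compat; lra).
  assert (El : l * (m - c) = u m) by (unfold l; field; lra).
  assert (X : 0 <= infty_op (l / 2) (2 * 1)).
  { apply Hz. set (b := Rmin e (Rmin (m - c) (l / 2))).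
    assert (Hb : 0 < b /\ b <= e /\ b <= m - c /\ b <= l / 2)
      by (unfold b, Rmin; repeat destruct Rle_dec; lra).
    apply (locally_open_interval (c - b) (c + b)); [lra |].
    intros y Hy. rewrite Hu0.
    destruct (Rtotal_order y c) as [Lt | [-> | Gt]].
    - assert (Y := Hpos y ltac:(lra)). nra.
    - rewrite Hu0. nra.
    - assert (Z := concave_of_quad_below a u c d c y m Hc Hq
                     ltac:(lra) ltac:(lra) ltac:(lra)).
      rewrite Hu0 in Z. rewrite <- El in Z.
      assert (l * (y - c) <= u y) by nra. nra. }
  unfold infty_op in X. nra.
Qed.

Lemma tiled_of_infty_fucik (z : R * R) (u : R -> R) :
  nontrivial u -> infty_fucik_solution (fst z) (snd z) u -> tiled 1 z.
Proof.
  intros Hnt Hsol.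
  apply (tiled_of_symmetric_class 1 quad_fucik) with (u := fun x => u (clamp x)).
  - intros z' u' H. apply H.
  - exact quad_fucik_opp.
  - exact quad_fucik_reflect.
  - clear. intros z u c d m [[Hc _] H] [A1 [A2 [A3 [A4 [A5 A6]]]]] Hm Hmax.
    simpl in A6.
    assert (Hu : forall t, c < t < d -> 0 < u t <= u m).
    { intros t Ht. split; [now apply A6 | apply Hmax; lra]. }
    assert (Hq : forall t, c < t < d -> quad_at (infty_rate_op (fst z) (u t)) u t).
    { intros t Ht. apply (H t); [unfold Omega; lra | now apply A6]. }
    assert (L := half_arc_lower (fst z) u c d m Hc Hm A4 Hu
                   (fun t Ht => proj1 (Hq t Ht))).
    split; [nra |]. split; [split; [exact L |] |].
    + apply (half_arc_upper (fst z) u c d m); try assumption.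
      intros t Ht. apply (Hq t Ht).
    + intros Hc0. apply (arc_crosses_zero (fst z) u c d m); try assumption.
      * apply A6. lra.
      * intros t Ht. apply (Hq t Ht).
      * apply (H c); [unfold Omega; lra | exact A4].
  - now apply quad_fucik_of_infty.
  - destruct Hnt as [x [Hx Hux]]. exists x. split; [exact Hx |].
    unfold Omega in Hx. rewrite clamp_id; [exact Hux | lra].
Qed.

(** * Solutions of the p-problem *)

Lemma rpow_pos (t r : R) : 0 < t -> rpow t r = Rpower t r.
Proof. intros H. unfold rpow. destruct Rlt_dec; [reflexivity | lra]. Qed.

Lemma rpow_npos (t r : R) : t <= 0 -> rpow t r = 0.
Proof. intros H. unfold rpow. destruct Rlt_dec; lra. Qed.

Lemma rpow_gt0 (t r : R) : 0 < t -> 0 < rpow t r.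
Proof. intros H. rewrite rpow_pos by exact H. apply exp_pos. Qed.

Lemma rpow_ge0 (t r : R) : 0 <= rpow t r.
Proof.
  unfold rpow. destruct Rlt_dec; [left; apply exp_pos | lra].
Qed.

Lemma rpow_one (r : R) : rpow 1 r = 1.
Proof.
  rewrite rpow_pos by lra. unfold Rpower. rewrite ln_1, Rmult_0_r. apply exp_0.
Qed.

Lemma rpow_1 (t : R) : 0 <= t -> rpow t 1 = t.
Proof.
  intros [H | <-]; [| rewrite rpow_npos; lra].
  rewrite rpow_pos by exact H. now apply Rpower_1.
Qed.

Lemma rpow_mult (s t r : R) : 0 <= s -> 0 <= t -> rpow (s * t) r = rpow s r * rpow t r.
Proof.
  intros [Hs | <-] [Ht | <-]; rewrite ?Rmult_0_l, ?Rmult_0_r, ?(rpow_npos 0);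
    try lra.
  assert (0 < s * t) by nra.
  rewrite !rpow_pos by assumption. symmetry. now apply Rpower_mult_distr.
Qed.

Lemma rpow_rpow (t r q : R) : 0 <= t -> rpow (rpow t r) q = rpow t (r * q).
Proof.
  intros [H | <-].
  - rewrite (rpow_pos (rpow t r)) by (now apply rpow_gt0).
    rewrite !rpow_pos by exact H. apply Rpower_mult.
  - now rewrite !(rpow_npos 0) by lra.
Qed.

Lemma rpow_plus (t r q : R) : 0 <= t -> rpow t (r + q) = rpow t r * rpow t q.
Proof.
  intros [H | <-].
  - rewrite !rpow_pos by exact H. apply Rpower_plus.
  - rewrite !(rpow_npos 0) by lra. ring.
Qed.

Lemma rpow_lt (s t r : R) : 0 < r -> 0 <= s < t -> rpow s r < rpow t r.
Proof.
  intros Hr [[Hs | <-] Ht].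
  - rewrite !rpow_pos by lra. unfold Rpower. apply exp_increasing.
    apply Rmult_lt_compat_l; [exact Hr |]. now apply ln_increasing.
  - rewrite (rpow_npos 0) by lra. now apply rpow_gt0.
Qed.

Lemma rpow_le (s t r : R) : 0 < r -> 0 <= s <= t -> rpow s r <= rpow t r.
Proof.
  intros Hr [Hs [Ht | <-]]; [| lra]. left. now apply rpow_lt.
Qed.

Lemma rpow_le_inv (s t r : R) : 0 < r -> 0 <= s -> 0 <= t ->
  rpow s r <= rpow t r -> s <= t.
Proof.
  intros Hr Hs Ht H. apply Rnot_lt_le. intros L.
  assert (X := rpow_lt t s r Hr (conj Ht L)). lra.
Qed.

Lemma rpow_root (t p : R) : 0 < p -> 0 <= t -> rpow (rpow t (/ p)) p = t.
Proof.
  intros Hp Ht. rewrite rpow_rpow by exact Ht.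
  rewrite Rinv_l by lra. now apply rpow_1.
Qed.

Lemma root_rpow (t p : R) : 0 < p -> 0 <= t -> rpow (rpow t p) (/ p) = t.
Proof.
  intros Hp Ht. rewrite rpow_rpow by exact Ht.
  rewrite Rinv_r by lra. now apply rpow_1.
Qed.

Lemma is_derive_pos_nbhd (f : R -> R) (x l : R) :
  is_derive f x l -> 0 < l ->
  exists e, 0 < e /\
    forall y, Rabs (y - x) < e -> y <> x -> 0 < (f y - f x) * (y - x).
Proof.
  intros H Hl. apply is_derive_Reals in H.
  destruct (H l Hl) as [[e He] Hd]. exists e. split; [exact He |].
  intros y Hy Hne. specialize (Hd (y - x) ltac:(lra) Hy).
  replace (x + (y - x)) with y in Hd by ring.
  apply Rabs_def2 in Hd.
  replace ((f y - f x) * (y - x)) with ((f y - f x) / (y - x) * (y - x) ^ 2)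
    by (field; lra).
  apply Rmult_lt_0_compat; [lra |]. apply pow2_gt_0. lra.
Qed.

Lemma fermat_max (f : R -> R) (x l : R) :
  is_derive f x l -> locally x (fun y => f y <= f x) -> l = 0.
Proof.
  intros H Hloc. apply locally_R in Hloc. destruct Hloc as [e [He Hloc]].
  destruct (Rtotal_order l 0) as [L | [E | G]]; [exfalso | exact E | exfalso].
  - apply (is_derive_opp f) in H.
    destruct (is_derive_pos_nbhd _ _ _ H) as [e' [He' Hn]].
    { change (0 < - l). lra. }
    set (y := x - Rmin e e' / 2).
    assert (0 < Rmin e e') by (now apply Rmin_glb_lt).
    assert (Hy : y < x) by (unfold y; lra).
    assert (B : Rabs (y - x) < Rmin e e').
    { unfold y. rewrite Rabs_left; lra. }
    assert (X := Hn y (Rlt_le_trans _ _ _ B (Rmin_r _ _)) ltac:(lra)).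
    assert (Y := Hloc y (Rlt_le_trans _ _ _ B (Rmin_l _ _))).
    change (0 < (- f y - - f x) * (y - x)) in X. nra.
  - destruct (is_derive_pos_nbhd _ _ _ H G) as [e' [He' Hn]].
    set (y := x + Rmin e e' / 2).
    assert (0 < Rmin e e') by (now apply Rmin_glb_lt).
    assert (Hy : x < y) by (unfold y; lra).
    assert (B : Rabs (y - x) < Rmin e e').
    { unfold y. rewrite Rabs_pos_eq; lra. }
    assert (X := Hn y (Rlt_le_trans _ _ _ B (Rmin_r _ _)) ltac:(lra)).
    assert (Y := Hloc y (Rlt_le_trans _ _ _ B (Rmin_l _ _))). nra.
Qed.

(** * The p-equation and its symmetries *)

Definition p_source (p a b t : R) : R :=
  a * rpow (pos_part t) (p - 1) - b * rpow (neg_part t) (p - 1).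

Definition p_fucik_at (p a b : R) (u : R -> R) (x : R) : Prop :=
  ex_derive u x /\ is_derive (p_flux p u) x (- p_source p a b (u x)).

Lemma p_flux_ext_loc (p : R) (u v : R -> R) (x : R) :
  locally x (fun y => u y = v y) ->
  locally x (fun y => p_flux p u y = p_flux p v y).
Proof.
  intros E. apply locally_locally in E. revert E. apply filter_imp.
  intros y Hy. unfold p_flux. now rewrite (Derive_ext_loc u v y Hy).
Qed.

Lemma p_fucik_at_ext (p a b : R) (u v : R -> R) (x : R) :
  locally x (fun y => u y = v y) -> p_fucik_at p a b u x -> p_fucik_at p a b v x.
Proof.
  intros E [H1 H2]. split.
  - now apply (ex_derive_ext_loc u).
  - rewrite <- (locally_singleton _ _ E).
    apply (is_derive_ext_loc (p_flux p u)); [now apply p_flux_ext_loc | exact H2].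
Qed.

Lemma p_fucik_solution_at (p a b : R) (u : R -> R) :
  p_fucik_solution p a b u <->
  continuous_dirichlet u /\ forall x, Omega x -> p_fucik_at p a b u x.
Proof.
  unfold p_fucik_solution, p_fucik_at, p_laplacian, p_source.
  split; intros [H0 H]; (split; [exact H0 |]); intros x Hx.
  - destruct (H x Hx) as [H1 [H2 H3]]. split; [exact H1 |].
    rewrite <- H3, Ropp_involutive. now apply Derive_correct.
  - destruct (H x Hx) as [H1 H2]. split; [exact H1 |].
    split; [eexists; exact H2 |]. rewrite (is_derive_unique _ _ _ H2). ring.
Qed.

Lemma p_flux_opp (p : R) (u : R -> R) (x : R) :
  p_flux p (fun y => - u y) x = - p_flux p u x.
Proof. unfold p_flux. rewrite Derive_opp, Rabs_Ropp. ring. Qed.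

Lemma p_fucik_at_opp (p a b : R) (u : R -> R) (x : R) :
  p_fucik_at p a b u x -> p_fucik_at p b a (fun y => - u y) x.
Proof.
  intros [H1 H2]. split; [now apply (ex_derive_opp u) |].
  apply (is_derive_ext (fun y => - p_flux p u y)).
  - intros y. symmetry. apply p_flux_opp.
  - replace (- p_source p b a (- u x)) with (- - p_source p a b (u x)).
    + now apply (is_derive_opp (p_flux p u)).
    + unfold p_source, pos_part, neg_part. rewrite (Ropp_involutive (u x)). ring.
Qed.

(* The class is parametrized by the rescaled values [z = (a^(1/p), b^(1/p))]. *)
Definition p_class (p : R) (z : R * R) (u : R -> R) : Prop :=
  ((forall x, continuous u x) /\ u 0 = 0 /\ u 1 = 0) /\
  nonneg_quadrant z /\
  forall x, Omega x -> p_fucik_at p (rpow (fst z) p) (rpow (snd z) p) u x.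

Lemma p_class_opp (p a b : R) (u : R -> R) :
  p_class p (a, b) u -> p_class p (b, a) (fun x => - u x).
Proof.
  intros [[Hc [H0 H1]] [[Hz1 Hz2] H]]. simpl in *. split; [repeat split |].
  - intros x. apply (continuous_opp u x (Hc x)).
  - lra.
  - lra.
  - split; [split; assumption |]. intros x Hx. apply p_fucik_at_opp. now apply H.
Qed.

Lemma is_derive_reflect (f : R -> R) (x l : R) :
  is_derive f (1 - x) l -> is_derive (fun y => f (1 - y)) x (- l).
Proof.
  intros H. replace (- l) with (scal (- 1) l) by (unfold scal; simpl; unfold mult; simpl; ring).
  apply (is_derive_comp f (fun y => 1 - y)); [exact H |].
  auto_derive; [trivial | ring].
Qed.

Lemma p_class_reflect (p : R) (z : R * R) (u : R -> R) :
  p_class p z u -> p_class p z (fun x => u (1 - x)).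
Proof.
  intros [[Hc [H0 H1]] [Hz H]]. split; [repeat split |].
  - now apply continuous_reflect.
  - now rewrite Rminus_0_r.
  - now rewrite Rminus_diag.
  - split; [exact Hz |].
    assert (HD : forall x, Omega x ->
      is_derive (fun y => u (1 - y)) x (- Derive u (1 - x))).
    { intros x Hx. apply is_derive_reflect. apply Derive_correct.
      apply H. unfold Omega in *. lra. }
    assert (HF : forall y, Omega y ->
      - p_flux p u (1 - y) = p_flux p (fun t => u (1 - t)) y).
    { intros y Hy. unfold p_flux.
      replace (Derive (fun t => u (1 - t)) y) with (- Derive u (1 - y))
        by (symmetry; now apply is_derive_unique, HD).
      rewrite Rabs_Ropp. ring. }
    intros x Hx. split; [eexists; now apply HD |].
    apply (is_derive_ext_loc (fun y => - p_flux p u (1 - y))).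
    + now apply (locally_open_interval 0 1).
    + set (l := p_source p (rpow (fst z) p) (rpow (snd z) p) (u (1 - x))).
      rewrite <- (Ropp_involutive (- l)).
      apply (is_derive_opp (fun y => p_flux p u (1 - y))).
      apply is_derive_reflect. apply H. unfold Omega in *. lra.
Qed.

Lemma p_flux_nonneg (p : R) (u : R -> R) (x : R) :
  0 <= Derive u x -> p_flux p u x = rpow (Derive u x) (p - 1).
Proof.
  intros H. unfold p_flux. rewrite Rabs_pos_eq by exact H.
  replace (p - 1) with (p - 2 + 1) by ring.
  rewrite rpow_plus by exact H. now rewrite rpow_1.
Qed.

Lemma p_flux_neg (p : R) (u : R -> R) (x : R) :
  Derive u x < 0 -> p_flux p u x < 0.
Proof.
  intros H. unfold p_flux.
  assert (0 < rpow (Rabs (Derive u x)) (p - 2)).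
  { apply rpow_gt0. rewrite Rabs_left; lra. }
  nra.
Qed.

Definition arc_ratio (p : R) : R := rpow (p * exp 1) (/ p).

(** The reciprocal of [1 - 1/p] is [1 + 1/(p - 1)], at most [exp (1/(p - 1))]; its power of order
    [p - 1] is therefore at most [e]. *)
Lemma one_minus_inv_pow (p : R) : 2 < p -> / exp 1 <= rpow (1 - / p) (p - 1).
Proof.
  intros Hp. assert (Hi : / p < 1) by (rewrite <- Rinv_1; apply Rinv_lt_contravar; lra).
  rewrite rpow_pos by lra. rewrite <- exp_Ropp. unfold Rpower.
  assert (L : ln (/ (1 - / p)) <= / (p - 1)).
  { apply Rnot_lt_le. intros L. apply exp_increasing in L.
    rewrite exp_ln in L.
    - assert (X := exp_ineq1_le (/ (p - 1))).
      replace (/ (1 - / p)) with (1 + / (p - 1)) in L by (field; lra). lra.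
    - apply Rinv_0_lt_compat. lra. }
  rewrite ln_Rinv in L by lra.
  assert (E : - 1 <= (p - 1) * ln (1 - / p)).
  { replace (- 1) with ((p - 1) * - / (p - 1)) by (field; lra).
    apply Rmult_le_compat_l; lra. }
  destruct E as [E | E]; [left; now apply exp_increasing | right; f_equal; lra].
Qed.

(** The flux vanishes at [m], so the mean value theorem on [[t, m]] expresses [u'(t)^(p-1)] as
    [a u(y)^(p-1) (m - t)] with some [y] between [t] and [m]. Lower bound: at a point [x] with
    [u(m) = u'(x) h] this gives [u(m)^(p-1) <= a h^p u(m)^(p-1)]. Upper bound: with [t = c + th h],
    the derivative decreases and [u] increases, so that [u(t) >= u'(t) th h] and
    [u'(t)^(p-1) >= a u(t)^(p-1) (1 - th) h]; hence [a h^p (1 - th) th^(p-1) <= 1]. The point of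
    positive flux serves to show that the slope at [c] is positive when [c] is an interior zero. *)
Lemma p_half_arc (p al a : R) (u : R -> R) (c m : R) :
  2 < p -> 0 <= al -> a = rpow al p -> c < m ->
  (forall x, continuous u x) -> u c = 0 ->
  (forall t, c < t <= m -> 0 < u t <= u m) ->
  (forall t, c < t <= m -> ex_derive u t /\
     is_derive (p_flux p u) t (- (a * rpow (u t) (p - 1)))) ->
  Derive u m = 0 ->
  1 <= al * (m - c) <= arc_ratio p /\
  exists t, c < t < m /\ 0 < p_flux p u t.
Proof.
  intros Hp Hal Ea Hcm Hc Hu0 Hu Hd Hdm.
  set (M := u m) in *. set (h := m - c).
  assert (HM : 0 < M) by (apply Hu; lra).
  assert (Hh : 0 < h) by (unfold h; lra).
  assert (Ha : 0 <= a) by (rewrite Ea; apply rpow_ge0).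
  assert (Hflux : forall s t, c < s < t -> t <= m -> exists x, s < x < t /\
    p_flux p u s = p_flux p u t + a * rpow (u x) (p - 1) * (t - s)).
  { intros s t Hs Ht.
    destruct (mean_value (p_flux p u) (fun x => - (a * rpow (u x) (p - 1))) s t)
      as [x [Hx E]].
    - lra.
    - intros x Hx. apply Hd. lra.
    - intros x Hx. apply (ex_derive_continuous (p_flux p u)).
      eexists. apply Hd. lra.
    - exists x. split; [exact Hx |]. lra. }
  assert (Hfm : p_flux p u m = 0).
  { unfold p_flux. rewrite Hdm. ring. }
  assert (Hf : forall t, c < t < m -> exists x, t < x < m /\
    rpow (Derive u t) (p - 1) = a * rpow (u x) (p - 1) * (m - t) /\ 0 <= Derive u t
    /\ p_flux p u t = rpow (Derive u t) (p - 1)).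
  { intros t Ht. destruct (Hflux t m) as [x [Hx E]]; [lra | lra |].
    exists x. split; [exact Hx |]. rewrite Hfm in E.
    assert (0 <= p_flux p u t).
    { rewrite E, Rplus_0_l. apply Rmult_le_pos; [| lra].
      apply Rmult_le_pos; [exact Ha | apply rpow_ge0]. }
    assert (P : 0 <= Derive u t).
    { apply Rnot_lt_le. intros L. apply (p_flux_neg p) in L. lra. }
    rewrite <- p_flux_nonneg by exact P. lra. }
  assert (Hmv : forall s t, c <= s < t -> t <= m -> exists x, s < x < t /\
    u t - u s = Derive u x * (t - s)).
  { intros s t Hs Ht. apply (mean_value u (Derive u)); [lra | |].
    - intros x Hx. apply Derive_correct. apply Hd. lra.
    - intros x _. apply Hc. }
  destruct (Hmv c m) as [x [Hx Ex]]; [lra | lra |].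
  fold M h in Ex. rewrite Hu0, Rminus_0_r in Ex.
  assert (Hdx : 0 < Derive u x) by nra.
  destruct (Hf x Hx) as [y [Hy [Ey [_ Fx]]]].
  assert (Elow : 1 <= a * rpow h p).
  { assert (X : rpow M (p - 1) <= rpow M (p - 1) * (a * rpow h p)).
    { rewrite Ex at 1. rewrite rpow_mult by lra. rewrite Ey.
      replace (rpow h p) with (rpow h (p - 1) * h).
      2: { rewrite <- (rpow_1 h) at 2 by lra. rewrite <- rpow_plus by lra.
           f_equal. ring. }
      assert (X1 : rpow (u y) (p - 1) <= rpow M (p - 1)).
      { apply rpow_le; [lra |]. assert (Z := Hu y ltac:(lra)). lra. }
      assert (X2 : rpow (u y) (p - 1) * (m - x) <= rpow M (p - 1) * h).
      { apply Rmult_le_compat; try lra; [apply rpow_ge0 | unfold h; lra]. }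
      assert (X3 : 0 <= a * rpow h (p - 1)).
      { apply Rmult_le_pos; [exact Ha | apply rpow_ge0]. }
      nra. }
    assert (Z := rpow_gt0 M (p - 1) HM). nra. }
  assert (Eh : a * rpow h p = rpow (al * h) p).
  { rewrite Ea, rpow_mult; lra. }
  split; [split |].
  - apply (rpow_le_inv 1 (al * h) p); try lra; [nra |].
    rewrite rpow_one. lra.
  - assert (Hi0 : 0 < / p) by (apply Rinv_0_lt_compat; lra).
    assert (Hi : / p < 1) by (rewrite <- Rinv_1; apply Rinv_lt_contravar; lra).
    (* This value maximizes [(1 - th) th^(p-1)], which becomes at least [1 / (e p)]. *)
    set (th := 1 - / p). assert (Hth : 0 < th < 1) by (unfold th; lra).
    set (t := c + th * h). assert (Ht : c < t < m) by (unfold t, h in *; nra).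
    destruct (Hf t Ht) as [y' [Hy' [Ey' [Pt _]]]].
    destruct (Hmv c t) as [x' [Hx' Ex']]; [lra | lra |].
    rewrite Hu0, Rminus_0_r in Ex'. replace (t - c) with (th * h) in Ex' by (unfold t; ring).
    assert (Hmono : Derive u t <= Derive u x').
    { destruct (Hf x') as [_ [_ [_ [Px' Fx']]]]; [lra |].
      destruct (Hf t Ht) as [_ [_ [_ [_ Ft]]]].
      apply (rpow_le_inv _ _ (p - 1)); try lra.
      rewrite <- Ft, <- Fx'.
      destruct (Hflux x' t) as [w [Hw Ew]]; [lra | lra |].
      assert (0 <= a * rpow (u w) (p - 1) * (t - x')).
      { apply Rmult_le_pos; [| lra].
        apply Rmult_le_pos; [exact Ha | apply rpow_ge0]. }
      lra. }
    assert (Huy : u t <= u y').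
    { destruct (Hmv t y') as [w [Hw Ew]]; [lra | lra |].
      destruct (Hf w) as [_ [_ [_ [Pw _]]]]; [lra |]. nra. }
    assert (Hut := Hu t ltac:(lra)).
    assert (Hthh : 0 < th * h) by nra.
    assert (X : rpow (u t) (p - 1) * (a * rpow h p * (/ p * rpow th (p - 1)))
                <= rpow (u t) (p - 1) * 1).
    { replace (rpow h p) with (rpow h (p - 1) * h).
      2: { rewrite <- (rpow_1 h) at 2 by lra. rewrite <- rpow_plus by lra.
           f_equal. ring. }
      rewrite Rmult_1_r.
      apply Rle_trans with (rpow (Derive u t * (th * h)) (p - 1)).
      - rewrite rpow_mult by lra. rewrite Ey', rpow_mult by lra.
        replace (m - t) with (/ p * h) by (unfold t, th, h; ring).
        assert (X1 : rpow (u t) (p - 1) <= rpow (u y') (p - 1)).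
        { apply rpow_le; lra. }
        assert (X2 : 0 <= a * (/ p * h) * (rpow th (p - 1) * rpow h (p - 1))).
        { apply Rmult_le_pos.
          - apply Rmult_le_pos; [exact Ha | nra].
          - apply Rmult_le_pos; apply rpow_ge0. }
        nra.
      - apply rpow_le; [lra |]. rewrite Ex'. split; [nra |].
        apply Rmult_le_compat_r; lra. }
    assert (Y := rpow_gt0 (u t) (p - 1) ltac:(lra)).
    apply Rmult_le_reg_l in X; [| exact Y].
    assert (Z := one_minus_inv_pow p Hp). fold th in Z.
    assert (He := exp_pos 1).
    assert (Hie := Rinv_0_lt_compat _ He).
    assert (X' : rpow (al * h) p <= p * exp 1).
    { rewrite <- Eh. apply Rmult_le_reg_r with (/ p * / exp 1).
      - nra.
      - replace (p * exp 1 * (/ p * / exp 1)) with 1 by (field; lra).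
        apply Rle_trans with (2 := X).
        apply Rmult_le_compat_l; [lra |]. apply Rmult_le_compat_l; lra. }
    unfold arc_ratio. rewrite <- (root_rpow (al * h) p); [| lra | nra].
    apply rpow_le; [exact Hi0 |]. split; [apply rpow_ge0 | exact X'].
  - exists x. split; [exact Hx |]. rewrite Fx. now apply rpow_gt0.
Qed.

Lemma tiled_of_p_class (p : R) (z : R * R) (u : R -> R) :
  2 < p -> p_class p z u -> nontrivial u -> tiled (arc_ratio p) z.
Proof.
  intros Hp. revert z u. apply tiled_of_symmetric_class.
  - intros z u H. apply H.
  - exact (p_class_opp p).
  - exact (p_class_reflect p).
  - intros z u c d m [[Hc _] [[Hz _] H]] [A1 [A2 [A3 [A4 [A5 A6]]]]] Hm Hmax.
    simpl in A6. set (a := rpow (fst z) p).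
    assert (Hu : forall t, c < t < d -> 0 < u t <= u m).
    { intros t Ht. split; [now apply A6 | apply Hmax; lra]. }
    assert (Hsrc : forall t, 0 <= u t ->
      p_source p a (rpow (snd z) p) (u t) = a * rpow (u t) (p - 1)).
    { intros t Ht. unfold p_source, pos_part, neg_part.
      rewrite (Rmax_right 0 (u t)), (Rmax_left 0 (- u t)), (rpow_npos 0) by lra.
      ring. }
    assert (Hd : forall t, c < t < d -> ex_derive u t /\
      is_derive (p_flux p u) t (- (a * rpow (u t) (p - 1)))).
    { intros t Ht. rewrite <- Hsrc by (assert (X := Hu t Ht); lra).
      apply (H t). unfold Omega. lra. }
    destruct (p_half_arc p (fst z) a u c m) as [B [t [Ht Hft]]]; try assumption.
    + reflexivity.
    + lra.
    + intros t Ht. apply Hu. lra.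
    + intros t Ht. apply Hd. lra.
    + apply (fermat_max u m).
      * apply Derive_correct. apply (Hd m Hm).
      * apply (locally_open_interval c d); [exact Hm |]. intros y Hy. now apply Hu.
    + split; [nra |]. split; [exact B |]. intros Hc0 e He.
      destruct (H c) as [Hdc Hfc]; [unfold Omega; lra |].
      fold a in Hfc. rewrite Hsrc in Hfc by lra.
      (* The flux decreases along a positive arc, so at [c] it is at least its positive value at
         [t]; then [u'(c) > 0] and [u] is negative just to the left of [c]. *)
      assert (Hfc0 : 0 < p_flux p u c).
      { destruct (mean_value (p_flux p u) (fun x => - (a * rpow (u x) (p - 1))) c t)
          as [x [Hx E]].
        - lra.
        - intros x Hx. apply Hd. lra.
        - intros x Hx. apply (ex_derive_continuous (p_flux p u)).
          destruct (Req_dec x c) as [-> |].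
          + eexists. exact Hfc.
          + eexists. apply Hd. lra.
        - assert (0 <= a * rpow (u x) (p - 1)).
          { apply Rmult_le_pos; apply rpow_ge0. }
          nra. }
      assert (Hpos : 0 < Derive u c).
      { apply Rnot_le_lt. intros [L | E].
        - apply (p_flux_neg p) in L. lra.
        - unfold p_flux in Hfc0. rewrite E in Hfc0. lra. }
      destruct (is_derive_pos_nbhd u c _ (Derive_correct _ _ Hdc) Hpos)
        as [e' [He' Hn]].
      set (y := c - Rmin e e' / 2).
      assert (0 < Rmin e e') by (now apply Rmin_glb_lt).
      assert (R1 := Rmin_l e e'). assert (R2 := Rmin_r e e').
      assert (Hy : c - e < y < c) by (unfold y; lra).
      exists y. split; [exact Hy |].
      assert (X := Hn y). rewrite A4 in X.
      assert (0 < (u y - 0) * (y - c)); [| nra].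
      apply X; [| lra]. unfold y. rewrite Rabs_left; lra.
Qed.

Lemma tiled_of_Sigma_p_rescaled (p : R) (w : R * R) :
  2 < p -> Sigma_p_rescaled p w -> tiled (arc_ratio p) w.
Proof.
  intros Hp [z [[u [Hnt Hu]] [[Hz1 Hz2] ->]]].
  apply p_fucik_solution_at in Hu. destruct Hu as [Hcd Hu].
  apply (tiled_of_p_class p _ (fun x => u (clamp x)) Hp).
  - split; [now apply clamp_dirichlet |]. simpl. split.
    + split; simpl; apply rpow_ge0.
    + intros x Hx. rewrite !rpow_root by lra.
      apply (p_fucik_at_ext p _ _ u); [now apply clamp_locally | now apply Hu].
  - destruct Hnt as [x [Hx Hux]]. exists x. split; [exact Hx |].
    unfold Omega in Hx. rewrite clamp_id; [exact Hux | lra].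
Qed.

(** * Gluing arcs, and existence for the limit problem *)

(** After the last arc the function continues as a line of slope 1 or -1, and the first arc is used
    to the left of 0 as well. Every zero, including the two boundary ones, thus has a two-sided
    neighbourhood and is treated in the same way. *)
Fixpoint chain (len : bool -> R) (b : bool -> R -> R) (s : bool) (n : nat)
  (x : R) : R :=
  match n with
  | O => signed s x
  | S m => if Rle_dec x (len s) then b s x
           else chain len b (negb s) m (x - len s)
  end.

(* [Reg] stands for a local form of the equation and [Zero s] for crossing zero
   in the direction of the sign [s], in a way which permits gluing. *)
Lemma chain_regular (Reg : (R -> R) -> R -> Prop)
  (Zero : bool -> (R -> R) -> R -> Prop)
  (len : bool -> R) (b : bool -> R -> R) (good : bool -> Prop) :
  (forall u v x, locally x (fun y => u y = v y) -> Reg u x -> Reg v x) ->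
  (forall s u v x, locally x (fun y => u y = v y) -> Zero s u x -> Zero s v x) ->
  (forall u x h, Reg u (x - h) -> Reg (fun y => u (y - h)) x) ->
  (forall s u x h, Zero s u (x - h) -> Zero s (fun y => u (y - h)) x) ->
  (forall s u v x, Zero s u x -> Zero s v x ->
     Zero s (fun y => if Rle_dec y x then u y else v y) x) ->
  (forall s u x, Zero s u x -> Reg u x) ->
  (forall s, Zero s (signed s) 0) ->
  (forall s, good s -> 0 < len s /\ Zero s (b s) 0 /\ Zero (negb s) (b s) (len s) /\
     forall x, 0 < x < len s -> Reg (b s) x) ->
  forall n s, ((1 <= n)%nat -> good s) -> ((2 <= n)%nat -> good (negb s)) ->
    0 <= tiling len s n /\
    Zero s (chain len b s n) 0 /\
    (exists s', Zero s' (chain len b s n) (tiling len s n)) /\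
    forall x, 0 < x < tiling len s n -> Reg (chain len b s n) x.
Proof.
  intros Rext Zext Rshift Zshift Zglue ZReg Zlin Hb.
  induction n as [| n IH]; intros s G1 G2.
  - simpl. split; [lra |]. split; [apply Zlin |].
    split; [exists s; apply Zlin | intros x Hx; lra].
  - destruct (Hb s (G1 ltac:(lia))) as [Hl [B1 [B2 B3]]].
    destruct (IH (negb s)) as [T0 [I1 [[s' I2] I3]]].
    { intros H. apply G2. lia. }
    { intros H. rewrite Bool.negb_involutive. apply G1. lia. }
    simpl tiling. set (l := len s) in *. set (T := tiling len (negb s) n) in *.
    set (v := fun y => chain len b (negb s) n (y - l)).
    change (chain len b s (S n)) with (fun y => if Rle_dec y l then b s y else v y).
    (* An arc of sign [s] leaves through zero in the direction [negb s], in which the remaining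
       chain sets out. *)
    assert (Hjoin : Zero (negb s) (fun y => if Rle_dec y l then b s y else v y) l).
    { apply Zglue; [exact B2 |]. apply Zshift. now rewrite Rminus_diag. }
    assert (Hleft : forall x, x < l ->
      locally x (fun y => b s y = (if Rle_dec y l then b s y else v y))).
    { intros x Hx. apply (locally_open_interval (x - 1) l); [lra |].
      intros y Hy. destruct Rle_dec; [reflexivity | lra]. }
    assert (Hright : forall x, l < x ->
      locally x (fun y => v y = (if Rle_dec y l then b s y else v y))).
    { intros x Hx. apply (locally_open_interval l (x + 1)); [lra |].
      intros y Hy. destruct Rle_dec; [lra | reflexivity]. }
    split; [lra |]. split; [| split].
    + apply (Zext _ (b s)); [now apply Hleft | exact B1].
    (* If the rest has length 0, as when no arc is left, the end of the chain is the joint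
       itself. *)
    + destruct (Req_dec T 0) as [E | E].
      * exists (negb s). now rewrite E, Rplus_0_r.
      * exists s'. apply (Zext _ v); [apply Hright; lra |].
        apply Zshift. now replace (l + T - l) with T by ring.
    + intros x Hx. destruct (Rtotal_order x l) as [L | [-> | G]].
      * apply (Rext (b s)); [now apply Hleft | apply B3; lra].
      * now apply (ZReg (negb s)).
      * apply (Rext v); [now apply Hright |]. apply Rshift, I3. lra.
Qed.

(** Nontriviality is read off from the slope of absolute value 1 at 0. *)
Lemma dirichlet_of_regular (Reg : (R -> R) -> R -> Prop)
  (Zero : bool -> (R -> R) -> R -> Prop) (u : R -> R) (s s' : bool) :
  (forall u x, Reg u x -> continuous u x) ->
  (forall s u x, Zero s u x -> u x = 0 /\ is_derive u x (signed s 1)) ->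
  Zero s u 0 -> Zero s' u 1 -> (forall x, 0 < x < 1 -> Reg u x) ->
  nontrivial u /\ continuous_dirichlet u.
Proof.
  intros HR HZ H0 H1 Hu.
  destruct (HZ _ _ _ H0) as [E0 D0]. destruct (HZ _ _ _ H1) as [E1 D1].
  split; [| split; [| now split]].
  - assert (D : is_derive (fun x => signed s (u x)) 0 1).
    { destruct s; [exact D0 |].
      replace 1 with (opp (-1)) by (unfold opp; simpl; ring).
      now apply (is_derive_opp u). }
    destruct (is_derive_pos_nbhd _ _ _ D Rlt_0_1) as [e [He Hn]].
    set (y := Rmin e 1 / 2).
    assert (Hy : 0 < y < 1 /\ y < e) by (unfold y, Rmin; destruct Rle_dec; lra).
    exists y. split; [unfold Omega; lra |]. intros E.
    assert (X := Hn y). rewrite E, E0 in X.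
    assert (0 < (signed s 0 - signed s 0) * (y - 0)); [| lra].
    apply X; [rewrite Rminus_0_r, Rabs_pos_eq |]; lra.
  - intros x Hx. unfold Omega_closure in Hx.
    assert (Hc : continuous u x).
    { destruct (Req_dec x 0) as [-> |]; [| destruct (Req_dec x 1) as [-> |]].
      - apply (ex_derive_continuous u). eexists. exact D0.
      - apply (ex_derive_continuous u). eexists. exact D1.
      - apply HR, Hu. lra. }
    intros P HP. now apply filter_le_within, Hc.
Qed.

(** * Test functions touching lines and peaks *)

Lemma second_order_max (phi : R -> R) (x k : R) :
  C2_on_Omega phi -> Omega x ->
  locally x (fun y => phi y <= phi x + k * (y - x)) ->
  Derive phi x = k /\ Derive_n phi 2 x <= 0.
Proof.
  intros Hphi Hx Hloc.
  destruct (Hphi x Hx) as [D1 [D2 _]].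
  assert (E : Derive phi x = k).
  { apply Rminus_diag_uniq.
    apply (fermat_max (fun y => phi y - k * (y - x)) x).
    - apply (is_derive_minus phi (fun y => k * (y - x))).
      + now apply Derive_correct.
      + auto_derive; [trivial | ring].
    - revert Hloc. apply filter_imp. intros y Hy. rewrite Rminus_diag. lra. }
  (* A positive second derivative would make the slope exceed [k] just to the right of [x], and
     [phi] would rise above the line. *)
  split; [exact E |]. apply Rnot_lt_le. intros L.
  destruct (is_derive_pos_nbhd (Derive phi) x _ (Derive_correct _ _ D2) L)
    as [e1 [He1 Hn]].
  apply locally_R in Hloc. destruct Hloc as [e2 [He2 Hloc]].
  unfold Omega in Hx.
  set (y := x + Rmin (Rmin e1 e2) (1 - x) / 2).
  assert (Hy : x < y < 1 /\ y < x + e1 /\ y < x + e2).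
  { unfold y, Rmin. repeat destruct Rle_dec; lra. }
  assert (DO : forall t, x <= t <= y -> ex_derive phi t).
  { intros t Ht. apply (Hphi t). unfold Omega. lra. }
  destruct (mean_value phi (Derive phi) x y) as [c [Hc Ec]].
  - lra.
  - intros t Ht. apply Derive_correct, DO. lra.
  - intros t Ht. now apply (ex_derive_continuous phi), DO.
  - assert (X := Hloc y). rewrite Rabs_pos_eq in X by lra.
    specialize (X ltac:(lra)).
    assert (Y := Hn c). rewrite Rabs_pos_eq in Y by lra.
    specialize (Y ltac:(lra) ltac:(lra)). rewrite E in Y. nra.
Qed.

Lemma second_order_min (phi : R -> R) (x k : R) :
  C2_on_Omega phi -> Omega x ->
  locally x (fun y => phi x + k * (y - x) <= phi y) ->
  Derive phi x = k /\ 0 <= Derive_n phi 2 x.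
Proof.
  intros Hphi Hx Hloc.
  destruct (second_order_max _ x (- k) (C2_opp phi Hphi) Hx) as [E1 E2].
  - revert Hloc. apply filter_imp. intros y. lra.
  - rewrite Derive_opp in E1. rewrite Derive_n_opp in E2. lra.
Qed.

Lemma infty_laplacian_unit (phi : R -> R) (x : R) (s : bool) :
  Derive phi x = signed s 1 -> infty_laplacian phi x = Derive_n phi 2 x.
Proof.
  intros E. unfold infty_laplacian. rewrite E. destruct s; simpl signed; ring.
Qed.

Lemma slope_at_cone (phi : R -> R) (x : R) :
  ex_derive phi x -> locally x (fun y => phi x - Rabs (y - x) <= phi y) ->
  Rabs (Derive phi x) <= 1.
Proof.
  intros D Hloc. apply locally_R in Hloc. destruct Hloc as [e [He Hloc]].
  apply Derive_correct in D.
  apply Rabs_le. split; apply Rnot_lt_le; intros L.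
  - assert (D' : is_derive (fun y => - (y - x) - phi y) x (- 1 - Derive phi x)).
    { apply (is_derive_minus (fun y => - (y - x)) phi); [| exact D].
      auto_derive; [trivial | ring]. }
    destruct (is_derive_pos_nbhd _ _ _ D') as [e' [He' Hn]]; [lra |].
    set (y := x + Rmin e e' / 2).
    assert (Hy : x < y /\ y < x + e /\ y < x + e')
      by (unfold y, Rmin; destruct Rle_dec; lra).
    assert (X := Hloc y). assert (Y := Hn y).
    rewrite Rabs_pos_eq in X, Y by lra.
    specialize (X ltac:(lra)). specialize (Y ltac:(lra) ltac:(lra)). nra.
  - assert (D' : is_derive (fun y => phi y - (y - x)) x (Derive phi x - 1)).
    { apply (is_derive_minus phi (fun y => y - x)); [exact D |].
      auto_derive; [trivial | ring]. }
    destruct (is_derive_pos_nbhd _ _ _ D') as [e' [He' Hn]]; [lra |].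
    set (y := x - Rmin e e' / 2).
    assert (Hy : y < x /\ x - e < y /\ x - e' < y)
      by (unfold y, Rmin; destruct Rle_dec; lra).
    assert (X := Hloc y). assert (Y := Hn y).
    rewrite Rabs_left in X, Y by lra.
    specialize (X ltac:(lra)). specialize (Y ltac:(lra) ltac:(lra)). nra.
Qed.

(** One of the two local shapes of a chain of tents. The second clause is the gradient condition
    [alpha u^+ <= |u'|], respectively [beta u^- <= |u'|], for slopes of absolute value 1; at a zero
    of [u] it is void. *)
Definition line_germ (z : R * R) (u : R -> R) (x : R) : Prop :=
  (exists s, locally x (fun y => u y = u x + signed s (y - x))) /\
  forall s, 0 < signed s (u x) -> rate z s * signed s (u x) <= 1.

(** The height is exactly the reciprocal of the rate: test functions touching a positive peak from
    above have slopes between -1 and 1, so the subsolution condition holds through its gradient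
    term. *)
Definition peak_germ (z : R * R) (u : R -> R) (x : R) : Prop :=
  exists s, 0 < signed s (u x) /\ rate z s * signed s (u x) = 1 /\
    locally x (fun y => signed s (u y) = signed s (u x) - Rabs (y - x)).

Lemma line_germ_touch (z : R * R) (u phi : R -> R) (x : R) :
  line_germ z u x -> C2_on_Omega phi -> Omega x ->
  (locally x (fun y => u y - phi y <= u x - phi x) ->
     Rabs (Derive phi x) = 1 /\ 0 <= infty_laplacian phi x) /\
  (locally x (fun y => u x - phi x <= u y - phi y) ->
     Rabs (Derive phi x) = 1 /\ infty_laplacian phi x <= 0).
Proof.
  intros [[s Hs] _] Hphi Hx.
  assert (Es : forall t, signed s t = signed s 1 * t).
  { intros t. destruct s; simpl; ring. }
  assert (Ea : Rabs (signed s 1) = 1).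
  { destruct s; simpl; [apply Rabs_R1 | rewrite Rabs_Ropp; apply Rabs_R1]. }
  split; intros Hloc.
  - destruct (second_order_min phi x (signed s 1) Hphi Hx) as [E1 E2].
    + generalize (filter_and _ _ Hs Hloc). apply filter_imp.
      intros y [Hy1 Hy2]. rewrite Es in Hy1. lra.
    + rewrite (infty_laplacian_unit phi x s E1), E1. now split.
  - destruct (second_order_max phi x (signed s 1) Hphi Hx) as [E1 E2].
    + generalize (filter_and _ _ Hs Hloc). apply filter_imp.
      intros y [Hy1 Hy2]. rewrite Es in Hy1. lra.
    + rewrite (infty_laplacian_unit phi x s E1), E1. now split.
Qed.

(** On a line every touching function has slope 1 or -1, and the side of contact fixes the sign of
    its second derivative. At a peak, contact from above bounds the slope by 1, which is [alpha u];
    contact from below is impossible, as the derivative would have to equal every number in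
    [[-1, 1]]. *)
Lemma viscosity_pos_of_germ (z : R * R) (u : R -> R) (x : R) :
  Omega x -> 0 < u x -> line_germ z u x \/ peak_germ z u x ->
  viscosity_at (fun phi x => Rmin (- infty_laplacian phi x)
                    (Rabs (Derive phi x) - fst z * pos_part (u x))) u x.
Proof.
  intros Hx Hu Hg.
  assert (Ep : pos_part (u x) = u x) by (unfold pos_part; apply Rmax_right; lra).
  destruct Hg as [Hg | [s [Hs1 [Hs2 Hs3]]]].
  - split; intros phi Hphi Hloc; rewrite Ep.
    + destruct (proj1 (line_germ_touch z u phi x Hg Hphi Hx) Hloc) as [_ E].
      apply Rle_trans with (1 := Rmin_l _ _). lra.
    + destruct (proj2 (line_germ_touch z u phi x Hg Hphi Hx) Hloc) as [E1 E2].
      rewrite E1. apply Rmin_glb; [lra |].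
      assert (X := proj2 Hg true Hu). simpl in X. lra.
  - destruct s; simpl in *; [| lra].
    split; intros phi Hphi Hloc; rewrite Ep.
    + apply Rle_trans with (1 := Rmin_r _ _).
      assert (Rabs (Derive phi x) <= 1); [| lra].
      apply slope_at_cone; [now apply Hphi |].
      generalize (filter_and _ _ Hs3 Hloc). apply filter_imp.
      intros y [Hy1 Hy2]. lra.
    + exfalso.
      assert (T : forall k, -1 <= k <= 1 -> Derive phi x = k).
      { intros k Hk. apply (second_order_max phi x k Hphi Hx).
        generalize (filter_and _ _ Hs3 Hloc). apply filter_imp.
        intros y [Hy1 Hy2].
        assert (- Rabs (y - x) <= k * (y - x)); [| lra].
        unfold Rabs; destruct Rcase_abs; nra. }
      assert (T1 := T 1 ltac:(lra)). assert (T2 := T (-1) ltac:(lra)). lra.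
Qed.

Lemma infty_fucik_at_of_germ (z : R * R) (u : R -> R) (x : R) :
  Omega x -> line_germ z u x \/ peak_germ z u x -> infty_fucik_at z u x.
Proof.
  intros Hx Hg. split; [| split]; intros Hu.
  - now apply viscosity_pos_of_germ.
  - replace u with (fun y => - - u y)
      by (apply functional_extensionality; intros y; apply Ropp_involutive).
    destruct z as [a b].
    apply (viscosity_opp _ (fun phi x => Rmin (- infty_laplacian phi x)
             (Rabs (Derive phi x) - fst (b, a) * pos_part (- u x))) (fun y => - u y)).
    + intros phi. rewrite infty_laplacian_opp, Derive_opp, Rabs_Ropp.
      unfold neg_part, pos_part. rewrite !Ropp_involutive.
      unfold Rmin, Rmax. simpl. repeat destruct Rle_dec; lra.
    + apply (viscosity_pos_of_germ (b, a) (fun y => - u y)); [exact Hx | lra |].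
      destruct Hg as [[[s Hs] Hr] | [s [Hs1 [Hs2 Hs3]]]].
      * left. split.
        -- exists (negb s). revert Hs. apply filter_imp. intros y Hy.
           rewrite signed_negb. lra.
        -- intros s' Hs'. assert (X := Hr (negb s')).
           rewrite signed_negb in X. destruct s'; simpl in *; lra.
      * right. exists (negb s). destruct s; simpl in *; [lra |].
        split; [lra |]. split; [lra |]. revert Hs3. apply filter_imp.
        intros y Hy. lra.
  - destruct Hg as [Hg | [s [Hs _]]].
    + split; intros phi Hphi Hloc.
      * destruct (proj1 (line_germ_touch z u phi x Hg Hphi Hx) Hloc). lra.
      * destruct (proj2 (line_germ_touch z u phi x Hg Hphi Hx) Hloc). lra.
    + rewrite Hu in Hs. destruct s; simpl in Hs; lra.
Qed.

(** The tent continues affinely beyond its zeros 0 and [2 / k], where its germ is therefore that of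
    a full line. *)
Definition tent (k x : R) : R := / k - Rabs (x - / k).

Definition line_through (s : bool) (u : R -> R) (x : R) : Prop :=
  locally x (fun y => u y = signed s (y - x)).

Lemma locally_shift (P : R -> Prop) (x h : R) :
  locally (x - h) P -> locally x (fun y => P (y - h)).
Proof.
  intros H. apply locally_R in H. destruct H as [e [He H]].
  apply locally_R. exists e. split; [exact He |].
  intros y Hy. apply H. now replace (y - h - (x - h)) with (y - x) by ring.
Qed.

Lemma tent_germs (z : R * R) (s : bool) :
  0 < rate z s ->
  0 < tile z s /\
  line_through s (fun x => signed s (tent (rate z s) x)) 0 /\
  line_through (negb s) (fun x => signed s (tent (rate z s) x)) (tile z s) /\
  forall x, 0 < x < tile z s ->
    line_germ z (fun x => signed s (tent (rate z s) x)) x \/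
    peak_germ z (fun x => signed s (tent (rate z s) x)) x.
Proof.
  intros Hk. set (k := rate z s) in *. unfold tile. fold k.
  assert (Hi : 0 < / k) by (now apply Rinv_0_lt_compat).
  assert (Ei : k * / k = 1) by (apply Rinv_r; lra).
  replace (2 / k) with (2 * / k) by reflexivity.
  assert (L : forall y, y <= / k -> tent k y = y).
  { intros y Hy. unfold tent. rewrite Rabs_left1; lra. }
  assert (G : forall y, / k <= y -> tent k y = 2 * / k - y).
  { intros y Hy. unfold tent. rewrite Rabs_pos_eq; lra. }
  assert (SS : forall t, signed s (signed s t) = t) by (intros t; destruct s; simpl; lra).
  assert (Hrate : forall t, 0 < t <= / k -> forall s', 0 < signed s' (signed s t) ->
    rate z s' * signed s' (signed s t) <= 1).
  { intros t Ht s' Hs'. assert (s' = s) as ->.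
    { destruct s, s'; simpl in Hs'; try reflexivity; lra. }
    rewrite SS. fold k. nra. }
  split; [lra |]. split; [| split].
  - apply (locally_open_interval (- 1) (/ k)); [lra |]. intros y Hy.
    rewrite L by lra. f_equal. lra.
  - apply (locally_open_interval (/ k) (3 * / k)); [lra |]. intros y Hy.
    rewrite G by lra. rewrite signed_negb. destruct s; simpl; lra.
  - intros x Hx. destruct (Rtotal_order x (/ k)) as [A | [-> | B]].
    + left. split.
      * exists s. apply (locally_open_interval (- 1) (/ k)); [lra |]. intros y Hy.
        rewrite !L by lra. destruct s; simpl; lra.
      * rewrite L by lra. apply Hrate. lra.
    + right. exists s. rewrite L by lra. rewrite SS. split; [exact Hi |].
      split; [exact Ei |]. apply filter_forall. intros y. rewrite SS. reflexivity.
    + left. split.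
      * exists (negb s). apply (locally_open_interval (/ k) (x + 1)); [lra |].
        intros y Hy. rewrite !G by lra. destruct s; simpl; lra.
      * rewrite G by lra. apply Hrate. lra.
Qed.

Lemma Sigma_infty_of_tiled (z : R * R) : tiled 1 z -> Sigma_infty z.
Proof.
  intros [s [n [Hn [Hs [Hs' Ht]]]]].
  assert (E1 : tiling (tile z) s n = 1) by lra. clear Ht.
  set (b := fun s x => signed s (tent (rate z s) x)).
  set (Reg := fun u x => line_germ z u x \/ peak_germ z u x).
  destruct (chain_regular Reg line_through (tile z) b (fun s => 0 < rate z s))
    with (n := n) (s := s) as [_ [Z0 [[s' Z1] HR]]].
  - intros u v x E. assert (Ex := locally_singleton _ _ E). unfold Reg.
    intros [[[s1 H1] H2] | [s1 [H1 [H2 H3]]]].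
    + left. unfold line_germ. rewrite <- Ex. split; [| exact H2].
      exists s1. generalize (filter_and _ _ E H1). apply filter_imp.
      intros y [Hy1 Hy2]. now rewrite <- Hy1.
    + right. exists s1. rewrite <- Ex. repeat split; try assumption.
      generalize (filter_and _ _ E H3). apply filter_imp.
      intros y [Hy1 Hy2]. now rewrite <- Hy1.
  - intros s0 u v x E H. unfold line_through in *.
    generalize (filter_and _ _ E H). apply filter_imp.
    intros y [Hy1 Hy2]. now rewrite <- Hy1.
  - intros u x h [[[s1 H1] H2] | [s1 [H1 [H2 H3]]]].
    + left. split; [| exact H2]. exists s1.
      apply locally_shift in H1. revert H1. apply filter_imp.
      intros y Hy. rewrite Hy. do 2 f_equal. lra.
    + right. exists s1. repeat split; try assumption.
      apply locally_shift in H3. revert H3. apply filter_imp.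
      intros y Hy. rewrite Hy. do 2 f_equal. lra.
  - intros s0 u x h H. unfold line_through in *.
    apply locally_shift in H. revert H. apply filter_imp.
    intros y Hy. rewrite Hy. f_equal. lra.
  - intros s0 u v x Hu Hv. unfold line_through in *.
    generalize (filter_and _ _ Hu Hv). apply filter_imp.
    intros y [Hy1 Hy2]. now destruct Rle_dec.
  - intros s0 u x H. left. unfold line_through in H.
    assert (E : u x = 0).
    { rewrite (locally_singleton _ _ H). rewrite Rminus_diag. destruct s0; simpl; lra. }
    split.
    + exists s0. rewrite E. revert H. apply filter_imp. intros y Hy. lra.
    + intros s1. rewrite E. destruct s1; simpl; lra.
  - intros s0. unfold line_through. apply filter_forall. intros y. f_equal. lra.
  - intros s0 H. now apply tent_germs.
  - intros _. exact Hs.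
  - exact Hs'.
  - rewrite E1 in Z1, HR.
    destruct (dirichlet_of_regular Reg line_through (chain (tile z) b s n) s s')
      as [Hnt Hcd]; try assumption.
    + intros u x [[[s1 H1] H2] | [s1 [H1 [H2 H3]]]].
      * apply (continuous_ext_loc _ (fun y => u x + signed s1 (y - x))).
        -- revert H1. apply filter_imp. intros y Hy. now symmetry.
        -- apply (continuous_plus (fun _ => u x)); [apply continuous_const |].
           apply (signed_cont (fun y => y - x)).
           apply (continuous_minus (fun y : R => y)); [apply continuous_id |].
           apply continuous_const.
      * apply (continuous_ext_loc _
          (fun y => signed s1 (signed s1 (u x) - Rabs (y - x)))).
        -- revert H3. apply filter_imp. intros y Hy. rewrite <- Hy.
           destruct s1; simpl; lra.
        -- apply (signed_cont (fun y => signed s1 (u x) - Rabs (y - x))).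
           apply (continuous_minus (fun _ => signed s1 (u x)));
             [apply continuous_const |].
           apply (continuous_comp (fun y => y - x) Rabs);
             [| apply continuous_Rabs].
           apply (continuous_minus (fun y : R => y)); [apply continuous_id |].
           apply continuous_const.
    + intros s1 u x H. unfold line_through in H. split.
      * rewrite (locally_singleton _ _ H), Rminus_diag. destruct s1; simpl; lra.
      * apply (is_derive_ext_loc (fun y => signed s1 (y - x))).
        -- revert H. apply filter_imp. intros y Hy. now symmetry.
        -- destruct s1; simpl; auto_derive; trivial; ring.
    + exists (chain (tile z) b s n). split; [exact Hnt |]. split; [exact Hcd |].
      intros x Hx. apply infty_fucik_at_of_germ; [exact Hx |]. now apply HR.
Qed.

(** * The p-bump *)

(** Extended by 0 to negative arguments, the power with exponent above 1 is differentiable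
    everywhere, including at 0; the p-bump can thus be differentiated across its zeros. *)
Lemma is_derive_rpow (p t : R) :
  1 < p -> is_derive (fun s => rpow s p) t (p * rpow t (p - 1)).
Proof.
  intros Hp. destruct (Rtotal_order t 0) as [L | [-> | G]].
  - rewrite rpow_npos, Rmult_0_r by lra.
    apply (is_derive_ext_loc (fun _ => 0)); [| auto_derive; trivial].
    apply (locally_open_interval (t - 1) 0); [lra |].
    intros y Hy. now rewrite rpow_npos by lra.
  - rewrite (rpow_npos 0), Rmult_0_r by lra. apply is_derive_Reals.
    intros e He. exists (mkposreal _ (rpow_gt0 e (/ (p - 1)) He)).
    intros h Hh Hhe. simpl in Hhe. rewrite Rplus_0_l, (rpow_npos 0), !Rminus_0_r by lra.
    destruct (Rlt_dec 0 h) as [P | N].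
    + replace (rpow h p / h) with (rpow h (p - 1)).
      * rewrite Rabs_pos_eq by apply rpow_ge0. rewrite Rabs_pos_eq in Hhe by lra.
        rewrite <- (rpow_root e (p - 1)) by lra. apply rpow_lt; lra.
      * replace p with (p - 1 + 1) at 2 by ring.
        rewrite rpow_plus, rpow_1 by lra. field. lra.
    + rewrite rpow_npos by lra. unfold Rdiv. rewrite Rmult_0_l, Rabs_R0. exact He.
  - rewrite rpow_pos by exact G.
    apply (is_derive_ext_loc (fun s => Rpower s p)).
    + apply (locally_open_interval 0 (t + 1)); [lra |].
      intros y Hy. now rewrite rpow_pos by lra.
    + apply is_derive_Reals. now apply derivable_pt_lim_power.
Qed.

Lemma continuous_rpow (r t : R) : 0 < r -> continuous (fun s => rpow s r) t.
Proof.
  intros Hr. destruct (Rle_dec t 0) as [L | G].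
  - intros P HP. rewrite rpow_npos in HP by lra.
    apply locally_R in HP. destruct HP as [e [He HP]].
    apply locally_R. exists (rpow e (/ r)). split; [now apply rpow_gt0 |].
    intros y Hy. apply HP. rewrite Rminus_0_r, Rabs_pos_eq by apply rpow_ge0.
    destruct (Rle_dec y 0) as [Ly | Gy]; [now rewrite rpow_npos by lra |].
    rewrite <- (rpow_root e r) by lra. apply rpow_lt; [exact Hr |].
    apply Rabs_def2 in Hy. lra.
  - apply (continuous_ext_loc _ (fun s => Rpower s r)).
    + apply (locally_open_interval 0 (t + 1)); [lra |].
      intros y Hy. now rewrite rpow_pos by lra.
    + apply (ex_derive_continuous (fun s => Rpower s r)).
      eexists. apply is_derive_Reals. apply derivable_pt_lim_power. lra.
Qed.

(** The difference quotient of [S] is the reciprocal of that of [F], which is close to [l] because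
    [S] is continuous. *)
Lemma is_derive_inverse (F S : R -> R) (x l : R) :
  0 < l -> is_derive F (S x) l -> continuous S x ->
  locally x (fun y => F (S y) = y) -> is_derive S x (/ l).
Proof.
  intros Hl HF HS Hloc. apply is_derive_Reals in HF. apply is_derive_Reals.
  intros e He.
  (* The first bound gives [q > l / 2], hence [1 / (q l) < 2 / l^2]; the second then bounds the
     error by [e / 2]. *)
  set (e' := Rmin (l / 2) (e * l ^ 2 / 4)).
  assert (He' : 0 < e' /\ e' <= l / 2 /\ e' <= e * l ^ 2 / 4).
  { assert (0 < e * l ^ 2 / 4) by (assert (0 < l ^ 2) by (apply pow_lt; lra); nra).
    unfold e', Rmin. destruct Rle_dec; lra. }
  destruct (HF e' (proj1 He')) as [d Hd].
  assert (HS' : locally x (fun y => Rabs (S y - S x) < d)).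
  { apply (HS (fun t => Rabs (t - S x) < d)). apply locally_R. exists d. split; [apply cond_pos | trivial]. }
  destruct (proj1 (locally_R _ _) (filter_and _ _ Hloc HS')) as [r [Hr HH]].
  exists (mkposreal r Hr). intros k Hk Hkr. simpl in Hkr.
  destruct (HH (x + k)) as [E1 E2].
  { now replace (x + k - x) with k by ring. }
  assert (E0 := locally_singleton _ _ Hloc). cbv beta in E0.
  set (h := S (x + k) - S x) in *.
  assert (Eh : S x + h = S (x + k)) by (unfold h; ring).
  assert (Hh : h <> 0).
  { intros Z. rewrite Z, Rplus_0_r in Eh. rewrite <- Eh in E1. lra. }
  assert (X := Hd h Hh E2). rewrite Eh, E1, E0 in X.
  replace (x + k - x) with k in X by ring.
  set (q := k / h) in *.
  apply Rabs_def2 in X.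
  assert (Hq : l / 2 < q) by lra.
  replace (h / k - / l) with ((l - q) * / (q * l)).
  2: { unfold q. field. repeat split; lra. }
  assert (Hql : l ^ 2 / 2 < q * l) by nra.
  assert (Hl2 : 0 < l ^ 2) by (apply pow_lt; lra).
  assert (Hi : / (q * l) < / (l ^ 2 / 2)).
  { apply Rinv_lt_contravar; nra. }
  assert (Hi0 : 0 < / (q * l)) by (apply Rinv_0_lt_compat; lra).
  rewrite Rabs_mult, (Rabs_pos_eq (/ (q * l))) by lra.
  assert (Hb : Rabs (l - q) < e * l ^ 2 / 4) by (apply Rabs_def1; lra).
  apply Rle_lt_trans with (e * l ^ 2 / 4 * / (l ^ 2 / 2)).
  - apply Rmult_le_compat; try lra. apply Rabs_pos.
  - replace (e * l ^ 2 / 4 * / (l ^ 2 / 2)) with (e / 2) by (field; lra). lra.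
Qed.

(** By the mean value theorem each difference quotient at [x0] is a value of [df] nearby. This gives
    the derivatives at the top of the bump, where the inverse function argument breaks down. *)
Lemma is_derive_of_limit (f df : R -> R) (x0 : R) :
  continuous f x0 -> continuous df x0 ->
  (forall x, x <> x0 -> is_derive f x (df x)) -> is_derive f x0 (df x0).
Proof.
  intros Hf Hdf Hd. apply is_derive_Reals. intros e He.
  assert (X : locally x0 (fun y => Rabs (df y - df x0) < e)).
  { apply (Hdf (fun t => Rabs (t - df x0) < e)). apply locally_R. now exists e. }
  apply locally_R in X. destruct X as [d [Hd0 X]].
  exists (mkposreal d Hd0). intros h Hh Hhd. simpl in Hhd.
  assert (Hc : forall y, continuous f y).
  { intros y. destruct (Req_dec y x0) as [-> |]; [exact Hf |].
    apply (ex_derive_continuous f). eexists. now apply Hd. }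
  assert (M : exists c, Rabs (c - x0) < d /\ (f (x0 + h) - f x0) / h = df c).
  { destruct (Rlt_dec 0 h) as [P | N].
    - destruct (mean_value f df x0 (x0 + h)) as [c [Hc1 Hc2]]; try lra.
      + intros y Hy. apply Hd. lra.
      + intros y _. apply Hc.
      + exists c. rewrite Rabs_pos_eq in * by lra. split; [lra |].
        rewrite Hc2. field. lra.
    - destruct (mean_value f df (x0 + h) x0) as [c [Hc1 Hc2]]; try lra.
      + intros y Hy. apply Hd. lra.
      + intros y _. apply Hc.
      + exists c. rewrite Rabs_left in * by lra. split; [lra |].
        replace (f (x0 + h) - f x0) with (- (f x0 - f (x0 + h))) by ring.
        rewrite Hc2. field. lra. }
  destruct M as [c [Hc1 ->]]. now apply X.
Qed.

(** * The generalized sine as an inverse function *)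

Definition bump_weight (p s : R) : R := rpow (1 - rpow s p) (- / p).

(** The generalized arcsine. Multiplying [(|S'|^(p-2) S')' + (p-1) S^(p-1) = 0] by [S'] yields the
    first integral [|S'|^p + S^p = 1] for unit initial slope, so the time needed to reach height [t]
    is the integral of [(1 - s^p)^(-1/p)]. For negative [s] the weight is 1, which makes the bump
    affine there. *)
Definition bump_time (p t : R) : R := RInt (bump_weight p) 0 t.

Lemma one_minus_rpow_pos (p s : R) : 0 < p -> s < 1 -> 0 < 1 - rpow s p.
Proof.
  intros Hp Hs. destruct (Rle_dec s 0) as [L | G].
  - rewrite rpow_npos; lra.
  - assert (X := rpow_lt s 1 p Hp ltac:(lra)). rewrite rpow_one in X. lra.
Qed.

Lemma bump_weight_cont (p s : R) : 2 < p -> s < 1 -> continuous (bump_weight p) s.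
Proof.
  intros Hp Hs. apply (continuous_ext_loc _ (fun s => Rpower (1 - rpow s p) (- / p))).
  - apply (locally_open_interval (s - 1) 1); [lra |]. intros y Hy.
    unfold bump_weight. rewrite (rpow_pos (1 - rpow y p)); [reflexivity |].
    apply one_minus_rpow_pos; lra.
  - apply (continuous_comp (fun s => 1 - rpow s p) (fun t => Rpower t (- / p))).
    + apply (continuous_minus (fun _ => 1)); [apply continuous_const |].
      apply continuous_rpow. lra.
    + apply (ex_derive_continuous (fun t => Rpower t (- / p))).
      eexists. apply is_derive_Reals, derivable_pt_lim_power.
      apply one_minus_rpow_pos; lra.
Qed.

Lemma bump_weight_ge1 (p s : R) : 2 < p -> s < 1 -> 1 <= bump_weight p s.
Proof.
  intros Hp Hs. assert (P := one_minus_rpow_pos p s ltac:(lra) Hs).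
  assert (N := rpow_ge0 s p).
  unfold bump_weight. rewrite (rpow_pos (1 - rpow s p)) by exact P.
  rewrite Rpower_Ropp. rewrite <- Rinv_1 at 1.
  apply Rinv_le_contravar; [apply exp_pos |].
  rewrite <- (rpow_pos (1 - rpow s p)) by exact P.
  apply Rle_trans with (rpow 1 (/ p)); [| rewrite rpow_one; lra].
  apply rpow_le; [apply Rinv_0_lt_compat |]; lra.
Qed.

Lemma bump_time_derive (p t : R) :
  2 < p -> t < 1 -> is_derive (bump_time p) t (bump_weight p t).
Proof.
  intros Hp Ht. apply (is_derive_RInt (bump_weight p) (bump_time p) 0 t).
  - apply (locally_open_interval (t - 1) 1); [lra |]. intros y Hy.
    apply (RInt_correct (V := R_CompleteNormedModule)).
    apply (ex_RInt_continuous (V := R_CompleteNormedModule)).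
    intros s Hs. apply bump_weight_cont; [exact Hp |].
    unfold Rmax in Hs. destruct Rle_dec in Hs; lra.
  - now apply bump_weight_cont.
Qed.

Lemma bump_time_0 (p : R) : bump_time p 0 = 0.
Proof. apply (RInt_point (V := R_CompleteNormedModule)). Qed.

Lemma bump_time_growth (p s t : R) :
  2 < p -> s < t < 1 -> t - s <= bump_time p t - bump_time p s.
Proof.
  intros Hp Hst.
  destruct (mean_value (bump_time p) (bump_weight p) s t) as [c [Hc E]].
  - lra.
  - intros x Hx. apply bump_time_derive; lra.
  - intros x Hx. apply (ex_derive_continuous (bump_time p)). eexists.
    apply bump_time_derive; lra.
  - assert (X := bump_weight_ge1 p c Hp ltac:(lra)). nra.
Qed.

(* [1 - s^p >= 1 - s], and [(1 - s)^(-1/p)] has integral [p / (p - 1)]. *)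
Lemma bump_time_bound (p t : R) :
  2 < p -> t < 1 -> bump_time p t <= p / (p - 1).
Proof.
  intros Hp Ht.
  assert (P0 : 0 < p / (p - 1)) by (apply Rdiv_lt_0_compat; lra).
  assert (Hi : 0 < / p < 1).
  { split; [apply Rinv_0_lt_compat; lra |].
    rewrite <- Rinv_1. apply Rinv_lt_contravar; lra. }
  destruct (Rle_dec t 0) as [L | G].
  - destruct L as [L | ->]; [| rewrite bump_time_0; lra].
    assert (X := bump_time_growth p t 0 Hp ltac:(lra)). rewrite bump_time_0 in X. lra.
  (* The added term has derivative [- (1 - s)^(-1/p)], so [g] does not increase between 0 and [t],
     and it starts from [p / (p - 1)]. *)
  - set (g := fun s => bump_time p s + p / (p - 1) * Rpower (1 - s) (1 - / p)).
    assert (D : forall s, s < 1 -> is_derive g s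
              (bump_weight p s - Rpower (1 - s) (- / p))).
    { intros s Hs.
      apply (is_derive_plus (bump_time p)
               (fun s => p / (p - 1) * Rpower (1 - s) (1 - / p)) s (bump_weight p s)
               (- Rpower (1 - s) (- / p))); [now apply bump_time_derive |].
      assert (D1 : is_derive (fun s => Rpower (1 - s) (1 - / p)) s
                ((-1) * ((1 - / p) * Rpower (1 - s) (1 - / p - 1)))).
      { apply (is_derive_comp (fun t => Rpower t (1 - / p)) (fun s => 1 - s)).
        - apply is_derive_Reals, derivable_pt_lim_power. lra.
        - auto_derive; [trivial | ring]. }
      apply (is_derive_scal _ _ (p / (p - 1))) in D1.
      replace (- Rpower (1 - s) (- / p)) with
        (p / (p - 1) * (-1 * ((1 - / p) * Rpower (1 - s) (1 - / p - 1))));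
        [exact D1 |].
      replace (1 - / p - 1) with (- / p) by ring. field. lra. }
    destruct (mean_value g _ 0 t ltac:(lra) (fun s Hs => D s ltac:(lra)))
      as [c [Hc E]].
    + intros s Hs. apply (ex_derive_continuous g). eexists. apply D. lra.
    + assert (Hw : bump_weight p c <= Rpower (1 - c) (- / p)).
      { unfold bump_weight.
        assert (Q := one_minus_rpow_pos p c ltac:(lra) ltac:(lra)).
        rewrite (rpow_pos (1 - rpow c p)) by exact Q. rewrite !Rpower_Ropp.
        apply Rinv_le_contravar; [apply exp_pos |].
        rewrite <- (rpow_pos (1 - rpow c p)), <- (rpow_pos (1 - c)) by lra.
        apply rpow_le; [lra |].
        assert (rpow c p <= c); [| lra].
        replace p with (p - 1 + 1) by ring. rewrite rpow_plus, rpow_1 by lra.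
        assert (X := rpow_le c 1 (p - 1) ltac:(lra) ltac:(lra)).
        rewrite rpow_one in X. assert (Y := rpow_ge0 c (p - 1)). nra. }
      assert (G0 : g 0 = p / (p - 1)).
      { unfold g. rewrite bump_time_0, Rminus_0_r. unfold Rpower.
        rewrite ln_1, Rmult_0_r, exp_0. ring. }
      assert (Gt : bump_time p t <= g t).
      { unfold g. assert (X : 0 < Rpower (1 - t) (1 - / p)) by apply exp_pos. nra. }
      nra.
Qed.

(** The weight is unbounded near 1, so [L], the time to reach the top, is taken as a supremum
    instead of an integral up to 1. *)
Lemma bump_time_sup (p : R) :
  2 < p -> exists L, 1 <= L <= p / (p - 1) /\
    (forall t, t < 1 -> bump_time p t < L) /\
    (forall x, x < L -> exists t, t < 1 /\ bump_time p t = x).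
Proof.
  intros Hp.
  destruct (completeness (fun y => exists t, t < 1 /\ y = bump_time p t))
    as [L [Hub Hlub]].
  - exists (p / (p - 1)). intros y [t [Ht ->]]. now apply bump_time_bound.
  - exists (bump_time p 0), 0. split; [lra | reflexivity].
  - assert (Hlt : forall t, t < 1 -> bump_time p t < L).
    { intros t Ht. set (t' := (1 + t) / 2).
      assert (X := bump_time_growth p t t' Hp ltac:(unfold t'; lra)).
      assert (Y : bump_time p t' <= L).
      { apply Hub. exists t'. split; [unfold t'; lra | reflexivity]. }
      unfold t' in *. lra. }
    exists L. split; [split | split]; [| | exact Hlt |].
    + apply Rnot_lt_le. intros N.
      assert (P := Hlt 0 ltac:(lra)). rewrite bump_time_0 in P.
      set (t := (1 + L) / 2).
      assert (X := bump_time_growth p 0 t Hp ltac:(unfold t; lra)).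
      assert (Y := Hlt t ltac:(unfold t; lra)).
      rewrite bump_time_0 in X. unfold t in *. lra.
    + apply Hlub. intros y [t [Ht ->]]. now apply bump_time_bound.
    + intros x Hx.
      assert (T1 : exists t1, t1 < 1 /\ x < bump_time p t1).
      { apply NNPP. intros N. assert (L <= x); [| lra].
        apply Hlub. intros y [t [Ht ->]]. apply Rnot_lt_le. intros Q.
        apply N. now exists t. }
      destruct T1 as [t1 [H1 H1']].
      set (t0 := Rmin (Rmin x 0) t1 - 1).
      assert (H0 : t0 <= x - 1 /\ t0 <= - 1 /\ t0 < t1)
        by (unfold t0, Rmin; repeat destruct Rle_dec; lra).
      assert (X := bump_time_growth p t0 0 Hp ltac:(lra)). rewrite bump_time_0 in X.
      destruct (IVT_interv (fun t => bump_time p t - x) t0 t1) as [t [Ht Et]].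
      * intros a Ha. apply continuity_pt_filterlim.
        apply (continuous_minus (bump_time p)); [| apply continuous_const].
        apply (ex_derive_continuous (bump_time p)). eexists.
        apply bump_time_derive; lra.
      * lra.
      * lra.
      * lra.
      * exists t. split; lra.
Qed.

(** The inverse of [bump_time], written as a supremum so that it also takes the value 1 at the
    limiting time [L]. *)
Definition half_bump (p x : R) : R :=
  real (Lub_Rbar (fun t => t < 1 /\ bump_time p t <= x)).

Lemma half_bump_time (p t : R) : 2 < p -> t < 1 -> half_bump p (bump_time p t) = t.
Proof.
  intros Hp Ht. unfold half_bump.
  rewrite (is_lub_Rbar_unique _ (Finite t)); [reflexivity |]. split.
  - intros s [Hs Hs']. simpl. apply Rnot_lt_le. intros L.
    assert (X := bump_time_growth p t s Hp ltac:(lra)). lra.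
  - intros b Hb. apply (Hb t). split; [exact Ht | apply Rle_refl].
Qed.

Lemma half_bump_top (p L : R) :
  (forall t, t < 1 -> bump_time p t < L) -> half_bump p L = 1.
Proof.
  intros HL. unfold half_bump.
  rewrite (is_lub_Rbar_unique _ (Finite 1)); [reflexivity |]. split.
  - intros s [Hs _]. simpl. lra.
  - intros b Hb. destruct b as [b | |]; simpl; [| trivial |].
    + apply Rnot_lt_le. intros N.
      assert (X : Rbar_le ((1 + b) / 2) b).
      { apply Hb. split; [lra |]. left. apply HL. lra. }
      simpl in X. lra.
    + apply (Hb 0). split; [lra |]. left. apply HL. lra.
Qed.

Definition fold_at (L x : R) : R := L - Rabs (x - L).

Lemma fold_at_cont (L x : R) : continuous (fold_at L) x.
Proof.
  apply (continuous_minus (fun _ => L)); [apply continuous_const |].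
  apply (continuous_comp (fun y => y - L) Rabs); [| apply continuous_Rabs].
  apply (continuous_minus (fun y : R => y)); [apply continuous_id |].
  apply continuous_const.
Qed.

(** The derivative predicted by the first integral, with the sign of the rising or the falling
    half. *)
Definition bump_slope (p L : R) (S : R -> R) (x : R) : R :=
  (if Rle_dec x L then 1 else - 1) * rpow (1 - rpow (S x) p) (/ p).

(* [S] solves [(|S'|^(p-2) S')' + (p-1) (S^+)^(p-1) = 0] on the whole line, as
   it is affine outside of the bump. *)
Lemma p_bump_exists (p : R) :
  2 < p -> exists L S, 1 <= L <= p / (p - 1) /\
    S 0 = 0 /\ S (2 * L) = 0 /\
    is_derive S 0 1 /\ is_derive S (2 * L) (- 1) /\
    (forall x, 0 < x < 2 * L -> 0 < S x) /\
    (forall x, ex_derive S x) /\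
    (forall x, is_derive (p_flux p S) x (- ((p - 1) * rpow (S x) (p - 1)))).
Proof.
  intros Hp. destruct (bump_time_sup p Hp) as [L [HL [Hlt Hsurj]]].
  assert (Hi : 0 < / p < 1).
  { split; [apply Rinv_0_lt_compat; lra |].
    rewrite <- Rinv_1. apply Rinv_lt_contravar; lra. }
  set (S0 := half_bump p). set (S := fun x => S0 (fold_at L x)).
  assert (HS0L : S0 L = 1) by (now apply half_bump_top).
  assert (HS0le : forall x, x <= L -> S0 x <= 1).
  { intros x [Hx | ->]; [| lra]. destruct (Hsurj x Hx) as [t [Ht <-]].
    unfold S0. rewrite half_bump_time; lra. }
  assert (HS0mono : forall t y, t < 1 -> bump_time p t < y <= L -> t < S0 y).
  { intros t y Ht [H1 [H2 | ->]]; [| lra].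
    destruct (Hsurj y H2) as [t' [Ht' <-]].
    unfold S0. rewrite half_bump_time by lra. apply Rnot_le_lt. intros [N | N].
    - assert (X := bump_time_growth p t' t Hp ltac:(lra)). lra.
    - rewrite N in H1. lra. }
  assert (HS0cont : forall x, x < L -> continuous S0 x).
  { intros x Hx. destruct (Hsurj x Hx) as [t [Ht Et]].
    intros P HP. apply locally_R in HP. destruct HP as [e [He HP]].
    set (e' := Rmin (e / 2) ((1 - t) / 2)).
    assert (He' : 0 < e' /\ e' < e /\ t + e' < 1)
      by (unfold e', Rmin; destruct Rle_dec; lra).
    assert (X1 := bump_time_growth p (t - e') t Hp ltac:(lra)).
    assert (X2 := bump_time_growth p t (t + e') Hp ltac:(lra)).
    apply (locally_open_interval (bump_time p (t - e')) (bump_time p (t + e'))).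
    - lra.
    - intros y Hy. apply HP.
      assert (Ey : S0 x = t) by (rewrite <- Et; unfold S0; now apply half_bump_time).
      rewrite Ey.
      assert (Hy2 := Hlt (t + e') ltac:(lra)).
      destruct (Hsurj y) as [t' [Ht' <-]]; [lra |].
      assert (Z := HS0mono (t - e') (bump_time p t') ltac:(lra)
                     ltac:(assert (Q := Hlt t' Ht'); lra)).
      unfold S0 in *. rewrite half_bump_time in * by lra.
      assert (t' < t + e').
      { apply Rnot_le_lt. intros [N | N].
        - assert (Q := bump_time_growth p (t + e') t' Hp ltac:(lra)). lra.
        - rewrite N in Hy. lra. }
      apply Rabs_def1; lra. }
  assert (HfL : fold_at L L = L).
  { unfold fold_at. rewrite Rminus_diag, Rabs_R0. ring. }
  assert (Hfl : forall x, x <= L -> fold_at L x = x).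
  { intros x Hx. unfold fold_at. rewrite Rabs_left1; lra. }
  assert (Hfr : forall x, L <= x -> fold_at L x = 2 * L - x).
  { intros x Hx. unfold fold_at. rewrite Rabs_pos_eq; lra. }
  assert (Hfle : forall x, fold_at L x <= L).
  { intros x. unfold fold_at. assert (X := Rabs_pos (x - L)). lra. }
  assert (Hflt : forall x, x <> L -> fold_at L x < L).
  { intros x Hx. unfold fold_at. assert (X := Rabs_pos_lt (x - L) ltac:(lra)). lra. }
  assert (HScont : forall x, continuous S x).
  { intros x. destruct (Req_dec x L) as [-> | Hx].
    - intros P HP. unfold S in HP. rewrite HfL, HS0L in HP.
      apply locally_R in HP. destruct HP as [e [He HP]].
      assert (X := Hlt (1 - e) ltac:(lra)).
      apply locally_R. exists (L - bump_time p (1 - e)). split; [lra |].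
      intros y Hy. apply HP. unfold S.
      assert (F1 : bump_time p (1 - e) < fold_at L y) by (unfold fold_at; lra).
      assert (Y := HS0mono (1 - e) (fold_at L y) ltac:(lra) (conj F1 (Hfle y))).
      assert (Z := HS0le _ (Hfle y)). apply Rabs_def1; lra.
    - apply (continuous_comp (fold_at L) S0); [apply fold_at_cont |].
      now apply HS0cont, Hflt. }
  assert (HSlt : forall x, x <> L -> S x < 1).
  { intros x Hx. unfold S. destruct (Hsurj _ (Hflt x Hx)) as [t [Ht <-]].
    unfold S0. now rewrite half_bump_time. }
  assert (HSL : S L = 1) by (unfold S; now rewrite HfL).
  set (dS := bump_slope p L S).
  assert (HS0d : forall x, x < L ->
    is_derive S0 x (rpow (1 - rpow (S0 x) p) (/ p))).
  { intros x Hx. destruct (Hsurj x Hx) as [t [Ht Et]].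
    assert (Ex : S0 x = t) by (rewrite <- Et; unfold S0; now apply half_bump_time).
    assert (Q := one_minus_rpow_pos p t ltac:(lra) Ht).
    replace (rpow (1 - rpow (S0 x) p) (/ p)) with (/ bump_weight p (S0 x)).
    2: { rewrite Ex. unfold bump_weight. rewrite !(rpow_pos (1 - rpow t p)) by exact Q.
         rewrite Rpower_Ropp. apply Rinv_inv. }
    apply (is_derive_inverse (bump_time p)).
    - rewrite Ex. assert (X := bump_weight_ge1 p t Hp Ht). lra.
    - rewrite Ex. now apply bump_time_derive.
    - now apply HS0cont.
    - apply (locally_open_interval (x - 1) L); [lra |]. intros y Hy.
      destruct (Hsurj y) as [t' [Ht' <-]]; [lra |].
      unfold S0. now rewrite half_bump_time. }
  assert (HSd' : forall x, x <> L -> is_derive S x (dS x)).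
  { intros x Hx. unfold dS, bump_slope. destruct Rle_dec as [Le | Gt].
    - apply (is_derive_ext_loc S0).
      + apply (locally_open_interval (x - 1) L); [lra |].
        intros y Hy. unfold S. rewrite Hfl; [reflexivity | lra].
      + rewrite Rmult_1_l. unfold S. rewrite Hfl by lra. apply HS0d. lra.
    - apply (is_derive_ext_loc (fun y => S0 (2 * L - y))).
      + apply (locally_open_interval L (x + 1)); [lra |].
        intros y Hy. unfold S. rewrite Hfr; [reflexivity | lra].
      + apply (is_derive_comp S0 (fun y => 2 * L - y)).
        * unfold S. rewrite Hfr by lra. apply HS0d. lra.
        * auto_derive; [trivial | ring]. }
  assert (HdSL : dS L = 0).
  { unfold dS, bump_slope. rewrite HSL, rpow_one, Rminus_diag, (rpow_npos 0) by lra. ring. }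
  assert (HdSc : continuous dS L).
  { assert (C : continuous (fun x => rpow (1 - rpow (S x) p) (/ p)) L).
    { apply (continuous_comp S (fun t => rpow (1 - rpow t p) (/ p))); [apply HScont |].
      apply (continuous_comp (fun t => 1 - rpow t p) (fun t => rpow t (/ p))).
      - apply (continuous_minus (fun _ => 1)); [apply continuous_const |].
        apply continuous_rpow. lra.
      - apply continuous_rpow. lra. }
    intros P HP. rewrite HdSL in HP.
    apply locally_R in HP. destruct HP as [e [He HP]].
    assert (CL : rpow (1 - rpow (S L) p) (/ p) = 0).
    { rewrite HSL, rpow_one, Rminus_diag, rpow_npos; lra. }
    assert (X : locally L (fun x => Rabs (rpow (1 - rpow (S x) p) (/ p)) < e)).
    { apply (C (fun t => Rabs t < e)). rewrite CL.
      apply locally_R. exists e. split; [exact He |]. intros y Hy.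
      now rewrite Rminus_0_r in Hy. }
    change (locally L (fun x => P (dS x))).
    revert X. apply filter_imp. intros y Hy. apply HP.
    rewrite Rminus_0_r. unfold dS, bump_slope.
    assert (Sg : Rabs (if Rle_dec y L then 1 else - 1) = 1).
    { destruct Rle_dec; unfold Rabs; destruct Rcase_abs; lra. }
    rewrite Rabs_mult, Sg, Rmult_1_l. exact Hy. }
  (* At the top the weight blows up; since [dS] tends to 0 there, the derivative is obtained as a
     limit. *)
  assert (HSd : forall x, is_derive S x (dS x)).
  { intros x. destruct (Req_dec x L) as [-> | Hx]; [| now apply HSd'].
    apply is_derive_of_limit; [apply HScont | exact HdSc | exact HSd']. }
  assert (Hflux : forall x, p_flux p S x = rpow (Rabs (dS x)) (p - 2) * dS x).
  { intros x. unfold p_flux. now rewrite (is_derive_unique _ _ _ (HSd x)). }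
  assert (HWl : forall x, x < L ->
    (* On the rising half the flux is [(1 - S^p)^((p-1)/p)]. Its derivative contains
       [S' = (1 - S^p)^(1/p)] and the factor [(1 - S^p)^(-1/p)], which cancel. *)
    is_derive (p_flux p S) x (- ((p - 1) * rpow (S x) (p - 1)))).
  { intros x Hx.
    apply (is_derive_ext_loc (fun y => Rpower (1 - rpow (S y) p) (/ p * (p - 1)))).
    - apply (locally_open_interval (x - 1) L); [lra |]. intros y Hy.
      assert (Q := one_minus_rpow_pos p (S y) ltac:(lra) (HSlt y ltac:(lra))).
      rewrite p_flux_nonneg; rewrite (is_derive_unique _ _ _ (HSd y));
        unfold dS, bump_slope; destruct Rle_dec; try lra; rewrite Rmult_1_l.
      + rewrite rpow_rpow by lra. now rewrite (rpow_pos (1 - rpow (S y) p)).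
      + apply rpow_ge0.
    - assert (Q := one_minus_rpow_pos p (S x) ltac:(lra) (HSlt x ltac:(lra))).
      assert (D1 : is_derive (fun y => 1 - rpow (S y) p) x
                     (- (dS x * (p * rpow (S x) (p - 1))))).
      { replace (- (dS x * (p * rpow (S x) (p - 1)))) with
          (0 - dS x * (p * rpow (S x) (p - 1))) by ring.
        apply (is_derive_minus (fun _ => 1) (fun y => rpow (S y) p)).
        - auto_derive; trivial.
        - apply (is_derive_comp (fun t => rpow t p) S); [| apply HSd].
          apply is_derive_rpow. lra. }
      assert (D2 := derivable_pt_lim_power (1 - rpow (S x) p) (/ p * (p - 1)) Q).
      apply is_derive_Reals in D2.
      assert (D := is_derive_comp (fun t => Rpower t (/ p * (p - 1))) _ x _ _ D2 D1).
      replace (- ((p - 1) * rpow (S x) (p - 1))) with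
        (scal (- (dS x * (p * rpow (S x) (p - 1))))
          (/ p * (p - 1) * Rpower (1 - rpow (S x) p) (/ p * (p - 1) - 1)));
        [exact D |].
      unfold scal; simpl; unfold mult; simpl.
      unfold dS, bump_slope. destruct Rle_dec as [_ |]; [| lra].
      rewrite (rpow_pos (1 - rpow (S x) p)), Rmult_1_l by exact Q.
      set (A := Rpower (1 - rpow (S x) p) (/ p)).
      set (B := Rpower (1 - rpow (S x) p) (/ p * (p - 1) - 1)).
      assert (AB : A * B = 1).
      { unfold A, B. rewrite <- Rpower_plus.
        replace (/ p + (/ p * (p - 1) - 1)) with 0 by (field; lra).
        now apply Rpower_O. }
      set (r := rpow (S x) (p - 1)).
      replace (- (A * (p * r)) * (/ p * (p - 1) * B))
        with (- ((p - 1) * r * (A * B))) by (field; lra).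
      rewrite AB. ring. }
  assert (HSsym : forall x, S (2 * L - x) = S x).
  { intros x. unfold S, fold_at. do 2 f_equal.
    replace (2 * L - x - L) with (- (x - L)) by ring. apply Rabs_Ropp. }
  (* The bump is symmetric about [L] and its flux is antisymmetric, so the falling half inherits the
     equation. *)
  assert (HWr : forall x, L < x ->
    is_derive (p_flux p S) x (- ((p - 1) * rpow (S x) (p - 1)))).
  { intros x Hx.
    apply (is_derive_ext_loc (fun y => - p_flux p S (2 * L - y))).
    - apply (locally_open_interval L (x + 1)); [lra |]. intros y Hy.
      rewrite !Hflux. unfold dS, bump_slope. rewrite HSsym.
      destruct (Rle_dec (2 * L - y) L), (Rle_dec y L); try lra.
      rewrite Rmult_1_l. replace (-1 * rpow (1 - rpow (S y) p) (/ p))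
        with (- rpow (1 - rpow (S y) p) (/ p)) by ring.
      rewrite Rabs_Ropp. unfold opp; simpl; ring.
    - assert (D := HWl (2 * L - x) ltac:(lra)). rewrite HSsym in D.
      assert (D' : is_derive (fun y => p_flux p S (2 * L - y)) x
                     (- 1 * - ((p - 1) * rpow (S x) (p - 1)))).
      { apply (is_derive_comp (p_flux p S) (fun y => 2 * L - y)); [exact D |].
        auto_derive; [trivial | ring]. }
      apply (is_derive_opp (fun y => p_flux p S (2 * L - y))) in D'.
      replace (- ((p - 1) * rpow (S x) (p - 1))) with
        (opp (- 1 * - ((p - 1) * rpow (S x) (p - 1)))); [exact D' |].
      unfold opp; simpl; ring. }
  assert (E0 : bump_time p 0 = 0) by apply bump_time_0.
  assert (S00 : S0 0 = 0).
  { unfold S0. rewrite <- E0 at 1. apply half_bump_time; lra. }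
  assert (ES0 : S 0 = 0) by (unfold S; rewrite Hfl; lra).
  assert (ES2 : S (2 * L) = 0).
  { rewrite <- HSsym. now replace (2 * L - 2 * L) with 0 by ring. }
  exists L, S. split; [exact HL |]. split; [exact ES0 |]. split; [exact ES2 |].
  split; [| split; [| split; [| split]]].
  - replace 1 with (dS 0); [apply HSd |].
    unfold dS, bump_slope. destruct Rle_dec; [| lra].
    rewrite ES0, (rpow_npos 0), Rminus_0_r, rpow_one; lra.
  - replace (- 1) with (dS (2 * L)); [apply HSd |].
    unfold dS, bump_slope. destruct Rle_dec; [lra |].
    rewrite ES2, (rpow_npos 0), Rminus_0_r, rpow_one; lra.
  - intros x Hx. unfold S. apply HS0mono; [lra |]. rewrite E0.
    split; [| apply Hfle]. unfold fold_at, Rabs. destruct Rcase_abs; lra.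
  - intros x. eexists. apply HSd.
  - intros x. destruct (Rtotal_order x L) as [A | [-> | B]].
    + now apply HWl.
    + apply (is_derive_of_limit (p_flux p S)
               (fun x => - ((p - 1) * rpow (S x) (p - 1)))).
      * apply (continuous_ext (fun x => rpow (Rabs (dS x)) (p - 2) * dS x)).
        { intros x. now rewrite Hflux. }
        apply (continuous_mult (fun x => rpow (Rabs (dS x)) (p - 2)) dS); [| exact HdSc].
        apply (continuous_comp (fun x => Rabs (dS x)) (fun t => rpow t (p - 2))).
        -- apply (continuous_comp dS Rabs); [exact HdSc | apply continuous_Rabs].
        -- apply continuous_rpow. lra.
      * apply (continuous_opp (fun x => (p - 1) * rpow (S x) (p - 1))).
        apply (continuous_mult (fun _ => p - 1)); [apply continuous_const |].
        apply (continuous_comp S (fun t => rpow t (p - 1))); [apply HScont |].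
        apply continuous_rpow. lra.
      * intros x Hx. destruct (Rlt_dec x L); [apply HWl | apply HWr]; lra.
    + now apply HWr.
Qed.

(** * Existence for the p-problem, and closedness of the tilings *)

(** Everything the equation involves at a zero: the source vanishes there, so the flux has
    derivative 0, and with equal slopes two such functions can be joined. *)
Definition flux_zero (p : R) (s : bool) (u : R -> R) (x : R) : Prop :=
  u x = 0 /\ is_derive u x (signed s 1) /\ is_derive (p_flux p u) x 0.

Lemma is_derive_shift (f : R -> R) (x h l : R) :
  is_derive f (x - h) l -> is_derive (fun y => f (y - h)) x l.
Proof.
  intros H. replace l with (scal 1 l) by (unfold scal; simpl; unfold mult; simpl; ring).
  apply (is_derive_comp f (fun y => y - h)); [exact H |].
  auto_derive; [trivial | ring].
Qed.

Lemma p_flux_shift (p : R) (u : R -> R) (h y : R) :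
  p_flux p (fun t => u (t - h)) y = p_flux p u (y - h).
Proof.
  unfold p_flux. replace (Derive (fun t => u (t - h)) y) with (Derive u (y - h));
    [reflexivity |].
  unfold Derive. f_equal. apply Lim_ext. intros k. do 3 f_equal. ring.
Qed.

Lemma is_derive_glue (f g : R -> R) (x l : R) :
  is_derive f x l -> is_derive g x l -> f x = g x ->
  is_derive (fun y => if Rle_dec y x then f y else g y) x l.
Proof.
  intros Hf Hg E. apply is_derive_Reals. apply is_derive_Reals in Hf, Hg.
  intros e He. destruct (Hf e He) as [d1 H1]. destruct (Hg e He) as [d2 H2].
  assert (Hd : 0 < Rmin d1 d2) by (apply Rmin_glb_lt; apply cond_pos).
  exists (mkposreal _ Hd). intros h Hh Hhd. simpl in Hhd.
  assert (M1 := Rmin_l d1 d2). assert (M2 := Rmin_r d1 d2).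
  destruct (Rle_dec x x) as [_ | N]; [| lra].
  destruct (Rle_dec (x + h) x); [apply H1 | rewrite E; apply H2]; lra.
Qed.

(** The flux of the glued function is the gluing of the fluxes: off [x] this is local, and at [x]
    the slopes agree. A second gluing then differentiates the flux. *)
Lemma flux_zero_glue (p : R) (s : bool) (u v : R -> R) (x : R) :
  flux_zero p s u x -> flux_zero p s v x ->
  flux_zero p s (fun y => if Rle_dec y x then u y else v y) x.
Proof.
  intros [U1 [U2 U3]] [V1 [V2 V3]].
  set (w := fun y => if Rle_dec y x then u y else v y).
  assert (W2 : is_derive w x (signed s 1)).
  { apply is_derive_glue; [exact U2 | exact V2 | lra]. }
  split; [| split].
  - unfold w. destruct Rle_dec; lra.
  - exact W2.
  - apply (is_derive_ext (fun y => if Rle_dec y x then p_flux p u y else p_flux p v y)).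
    + intros y. unfold p_flux.
      destruct (Rtotal_order y x) as [L | [-> | G]].
      * rewrite (Derive_ext_loc w u y); [destruct Rle_dec; [reflexivity | lra] |].
        apply (locally_open_interval (y - 1) x); [lra |]. intros t Ht.
        unfold w. destruct Rle_dec; [reflexivity | lra].
      * rewrite (is_derive_unique _ _ _ W2), (is_derive_unique _ _ _ U2).
        destruct Rle_dec; [reflexivity | lra].
      * rewrite (Derive_ext_loc w v y); [destruct Rle_dec; [lra | reflexivity] |].
        apply (locally_open_interval x (y + 1)); [lra |]. intros t Ht.
        unfold w. destruct Rle_dec; [lra | reflexivity].
    + apply is_derive_glue; [exact U3 | exact V3 |].
      unfold p_flux. now rewrite (is_derive_unique _ _ _ U2), (is_derive_unique _ _ _ V2).
Qed.

Lemma flux_zero_opp (p : R) (s : bool) (u : R -> R) (x : R) :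
  flux_zero p s u x -> flux_zero p (negb s) (fun y => - u y) x.
Proof.
  intros [U1 [U2 U3]]. split; [lra |]. split.
  - rewrite signed_negb. now apply (is_derive_opp u).
  - apply (is_derive_ext (fun y => - p_flux p u y)).
    + intros y. symmetry. apply p_flux_opp.
    + replace 0 with (- 0) by ring. now apply (is_derive_opp (p_flux p u)).
Qed.

(** Dividing by [m = L k] after dilating by [m] preserves slopes, hence the flux up to dilation, and
    brings the length [2 L] to [2 / k]. The flux gains a factor [m] on differentiation, and
    [S = m u] contributes [m^(p-1)]: together [m^p]. *)
Lemma scaled_bump (p L k b : R) (S : R -> R) :
  2 < p -> 0 < k -> 1 <= L ->
  S 0 = 0 -> S (2 * L) = 0 ->
  is_derive S 0 1 -> is_derive S (2 * L) (- 1) ->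
  (forall x, 0 < x < 2 * L -> 0 < S x) ->
  (forall x, ex_derive S x) ->
  (forall x, is_derive (p_flux p S) x (- ((p - 1) * rpow (S x) (p - 1)))) ->
  flux_zero p true (fun x => S (L * k * x) / (L * k)) 0 /\
  flux_zero p false (fun x => S (L * k * x) / (L * k)) (2 / k) /\
  forall x, 0 < x < 2 / k ->
    p_fucik_at p ((p - 1) * rpow (L * k) p) b (fun x => S (L * k * x) / (L * k)) x.
Proof.
  intros Hp Hk HL S0 S2 D0 D2 Spos Sex Sfl.
  set (m := L * k). assert (Hm : 0 < m) by (unfold m; nra).
  set (u := fun x => S (m * x) / m).
  assert (Du : forall x l, is_derive S (m * x) l -> is_derive u x l).
  { intros x l H.
    assert (H' : is_derive (fun x => S (m * x)) x (m * l)).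
    { apply (is_derive_comp S (fun x => m * x)); [exact H |].
      auto_derive; [trivial | ring]. }
    apply (is_derive_scal _ x (/ m)) in H'.
    replace l with (/ m * (m * l)) by (field; lra).
    assert (Eu : forall t, / m * S (m * t) = u t) by (intros t; unfold u; field; lra).
    exact (is_derive_ext _ _ _ _ Eu H'). }
  assert (Fu : forall x, p_flux p u x = p_flux p S (m * x)).
  { intros x. unfold p_flux.
    now rewrite (is_derive_unique _ _ _ (Du x _ (Derive_correct _ _ (Sex (m * x))))). }
  assert (DFu : forall x, is_derive (p_flux p u) x
                  (m * - ((p - 1) * rpow (S (m * x)) (p - 1)))).
  { intros x. apply (is_derive_ext (fun x => p_flux p S (m * x))).
    - intros t. now rewrite Fu.
    - apply (is_derive_comp (p_flux p S) (fun x => m * x)); [apply Sfl |].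
      auto_derive; [trivial | ring]. }
  assert (E2 : m * (2 / k) = 2 * L) by (unfold m; field; lra).
  assert (Z : forall x s, S (m * x) = 0 -> is_derive S (m * x) (signed s 1) ->
                          flux_zero p s u x).
  { intros x s E D. split; [| split].
    - unfold u. rewrite E. unfold Rdiv. ring.
    - now apply Du.
    - replace 0 with (m * - ((p - 1) * rpow (S (m * x)) (p - 1))); [apply DFu |].
      rewrite E, (rpow_npos 0) by lra. ring. }
  split; [| split].
  - apply Z; now rewrite Rmult_0_r.
  - apply Z; now rewrite E2.
  - intros x Hx. split.
    + eexists. apply Du, Derive_correct, Sex.
    + assert (Hmx : 0 < m * x < 2 * L).
      { split; [nra |]. rewrite <- E2. apply Rmult_lt_compat_l; lra. }
      assert (P := Spos _ Hmx).
      assert (P' : 0 < u x) by (now apply Rdiv_lt_0_compat).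
      replace (- p_source p ((p - 1) * rpow m p) b (u x)) with
        (m * - ((p - 1) * rpow (S (m * x)) (p - 1))); [apply DFu |].
      unfold p_source, pos_part, neg_part.
      rewrite (Rmax_right 0 (u x)), (Rmax_left 0 (- u x)), (rpow_npos 0) by lra.
      replace (S (m * x)) with (m * u x) by (unfold u; field; lra).
      rewrite rpow_mult by lra.
      replace (rpow m p) with (m * rpow m (p - 1)); [ring |].
      rewrite <- (rpow_1 m) at 1 by lra. rewrite <- rpow_plus by lra.
      f_equal. ring.
Qed.

(** Bumps are fitted to arcs of exactly the lengths of the limit problem. The coefficient
    [(p - 1) (L k)^p] has p-th root [rho k] with [rho = (p - 1)^(1/p) L], the same for both signs,
    so the tiled points are merely dilated by a factor depending on [p] alone. *)
Lemma Sigma_p_rescaled_of_tiled (p : R) :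
  2 < p -> exists rho, 1 <= rho <= arc_ratio p * (p / (p - 1)) /\
    forall z, nonneg_quadrant z -> tiled 1 z ->
      Sigma_p_rescaled p (rho * fst z, rho * snd z).
Proof.
  intros Hp.
  destruct (p_bump_exists p Hp) as [L [S [HL [S0 [S2 [D0 [D2 [Spos [Sex Sfl]]]]]]]]].
  assert (Hi : 0 < / p) by (apply Rinv_0_lt_compat; lra).
  exists (rpow (p - 1) (/ p) * L). split.
  { assert (R1 : 1 <= rpow (p - 1) (/ p)).
    { apply Rle_trans with (rpow 1 (/ p)); [rewrite rpow_one; lra |].
      apply rpow_le; lra. }
    assert (R2 : rpow (p - 1) (/ p) <= arc_ratio p).
    { apply rpow_le; [exact Hi |]. assert (X := exp_ineq1_le 1). nra. }
    split; [nra |]. apply Rmult_le_compat; lra. }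
  intros z [Hz1 Hz2] [s [n [Hn [Hs [Hs' Ht]]]]].
  assert (E1 : tiling (tile z) s n = 1) by lra. clear Ht.
  set (A := fun k => (p - 1) * rpow (L * k) p).
  set (b := fun s x => signed s (S (L * rate z s * x) / (L * rate z s))).
  set (Reg := p_fucik_at p (A (fst z)) (A (snd z))).
  destruct (chain_regular Reg (flux_zero p) (tile z) b (fun s => 0 < rate z s))
    with (n := n) (s := s) as [_ [Z0 [[s' Z1] HR]]].
  - intros u v x. apply p_fucik_at_ext.
  - intros s0 u v x E [H1 [H2 H3]]. split; [| split].
    + now rewrite <- (locally_singleton _ _ E).
    + now apply (is_derive_ext_loc u).
    + apply (is_derive_ext_loc (p_flux p u)); [now apply p_flux_ext_loc | exact H3].
  - intros u x h [[l H1] H2]. split.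
    + exists l. now apply is_derive_shift.
    + apply (is_derive_ext (fun y => p_flux p u (y - h))).
      * intros y. now rewrite p_flux_shift.
      * now apply is_derive_shift.
  - intros s0 u x h [H1 [H2 H3]]. split; [exact H1 |]. split.
    + now apply is_derive_shift.
    + apply (is_derive_ext (fun y => p_flux p u (y - h))).
      * intros y. now rewrite p_flux_shift.
      * now apply is_derive_shift.
  - apply flux_zero_glue.
  - intros s0 u x [H1 [H2 H3]]. split; [eexists; exact H2 |].
    rewrite H1. unfold p_source, pos_part, neg_part.
    rewrite Ropp_0, (Rmax_left 0 0), (rpow_npos 0) by lra.
    now replace (- (A (fst z) * 0 - A (snd z) * 0)) with 0 by ring.
  - intros s0.
    assert (D : forall x, is_derive (signed s0) x (signed s0 1)).
    { intros x. destruct s0; [apply (is_derive_id x) |].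
      apply (is_derive_opp (fun t : R => t) x 1), (is_derive_id x). }
    split; [destruct s0; simpl; ring |]. split; [apply D |].
    apply (is_derive_ext (fun _ => rpow (Rabs (signed s0 1)) (p - 2) * signed s0 1)).
    + intros t. unfold p_flux. now rewrite (is_derive_unique _ _ _ (D t)).
    + auto_derive; trivial.
  - intros s0 Hr. split; [apply Rdiv_lt_0_compat; lra |].
    unfold b, tile. destruct s0; simpl in *.
    + destruct (scaled_bump p L (fst z) (A (snd z)) S) as [B1 [B2 B3]]; try tauto; lra.
    + destruct (scaled_bump p L (snd z) (A (fst z)) S) as [B1 [B2 B3]]; try tauto; try lra.
      split; [now apply (flux_zero_opp p true) |].
      split; [now apply (flux_zero_opp p false) |].
      intros x Hx. apply p_fucik_at_opp. now apply B3.
  - intros _. exact Hs.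
  - exact Hs'.
  - rewrite E1 in Z1, HR.
    destruct (dirichlet_of_regular Reg (flux_zero p) (chain (tile z) b s n) s s')
      as [Hnt Hcd]; try assumption.
    + intros u x [H _]. now apply (ex_derive_continuous u).
    + intros s1 u x [H1 [H2 _]]. now split.
    + assert (HA : forall k, 0 <= k -> 0 <= A k /\
        rpow (A k) (/ p) = rpow (p - 1) (/ p) * L * k).
      { intros k Hk. assert (X := rpow_ge0 (L * k) p). unfold A. split; [nra |].
        rewrite rpow_mult by lra. rewrite root_rpow; [ring | lra | nra]. }
      destruct (HA _ Hz1) as [A1 A2]. destruct (HA _ Hz2) as [B1 B2].
      exists (A (fst z), A (snd z)). simpl. split; [| split].
      * exists (chain (tile z) b s n). split; [exact Hnt |].
        apply p_fucik_solution_at. split; [exact Hcd | exact HR].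
      * split; assumption.
      * now rewrite A2, B2.
Qed.

(** * Passing to the limit in tilings *)

Lemma eventually_ratio (e : R) :
  0 < e -> exists P, 2 <= P /\ forall p, P < p -> arc_ratio p < 1 + e.
Proof.
  intros He.
  assert (Hln : 0 < ln (1 + e)) by (rewrite <- ln_1; apply ln_increasing; lra).
  assert (H := is_lim_div_ln_p). apply is_lim_spec in H.
  destruct (H (mkposreal (ln (1 + e) / 2) ltac:(lra))) as [M HM]. simpl in HM.
  (* The logarithm of [arc_ratio p] is [ln p / p + 1 / p]; each summand is made smaller than half of
     [ln (1 + e)]. *)
  exists (Rmax (Rmax 2 M) (2 / ln (1 + e))).
  assert (M1 := Rmax_l (Rmax 2 M) (2 / ln (1 + e))).
  assert (M2 := Rmax_r (Rmax 2 M) (2 / ln (1 + e))).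
  assert (M3 := Rmax_l 2 M). assert (M4 := Rmax_r 2 M).
  split; [lra |]. intros p Hp.
  specialize (HM p ltac:(lra)). apply Rabs_def2 in HM.
  assert (Hpe : 0 < p * exp 1) by (assert (X := exp_pos 1); nra).
  unfold arc_ratio. rewrite rpow_pos by exact Hpe.
  unfold Rpower. rewrite <- (exp_ln (1 + e)) by lra. apply exp_increasing.
  rewrite ln_mult, ln_exp by (try apply exp_pos; lra).
  assert (Q : / p < ln (1 + e) / 2).
  { replace (ln (1 + e) / 2) with (/ (2 / ln (1 + e))) by (field; lra).
    assert (0 < 2 / ln (1 + e)) by (apply Rdiv_lt_0_compat; lra).
    apply Rinv_lt_contravar; nra. }
  unfold Rdiv in HM. lra.
Qed.

(** Bounds the number of arcs that fit into the unit interval; with [delta = 0] it yields the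
    nonnegativity of a tiling. *)
Lemma tiling_lower (w : R * R) (delta : R) :
  (forall s, 0 < rate w s -> delta <= tile w s) ->
  forall n s, ((1 <= n)%nat -> 0 < rate w s) -> ((2 <= n)%nat -> 0 < rate w (negb s)) ->
  INR n * delta <= tiling (tile w) s n.
Proof.
  intros H. induction n as [| n IH]; intros s H1 H2.
  - simpl. lra.
  - rewrite S_INR. simpl tiling.
    assert (X := H s (H1 ltac:(lia))).
    assert (Y : INR n * delta <= tiling (tile w) (negb s) n); [| lra].
    apply IH; [intros; apply H2; lia |].
    intros. rewrite Bool.negb_involutive. apply H1. lia.
Qed.

Lemma tile_pos (w : R * R) (s : bool) : 0 < rate w s -> 0 < tile w s.
Proof. intros H. apply Rdiv_lt_0_compat; lra. Qed.

Definition close_pair (e : R) (w z : R * R) : Prop :=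
  Rabs (fst w - fst z) < e /\ Rabs (snd w - snd z) < e.

Lemma close_pair_rate (e : R) (w z : R * R) (s : bool) :
  close_pair e w z -> Rabs (rate w s - rate z s) < e.
Proof. intros [H1 H2]. now destruct s. Qed.

Lemma tiling_cont (z : R * R) (n : nat) : forall s,
  ((1 <= n)%nat -> 0 < rate z s) -> ((2 <= n)%nat -> 0 < rate z (negb s)) ->
  forall eta, 0 < eta -> exists e, 0 < e /\ forall w, close_pair e w z ->
    Rabs (tiling (tile w) s n - tiling (tile z) s n) < eta.
Proof.
  induction n as [| n IH]; intros s H1 H2 eta Heta.
  - exists 1. split; [lra |]. intros w _. simpl. now rewrite Rminus_diag, Rabs_R0.
  - destruct (IH (negb s)) with (eta := eta / 2) as [e1 [He1 X1]].
    + intros. apply H2. lia.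
    + intros. rewrite Bool.negb_involutive. apply H1. lia.
    + lra.
    + assert (C : continuous (fun t => 2 / t) (rate z s)).
      { apply (ex_derive_continuous (fun t => 2 / t)). auto_derive.
        assert (Q := H1 ltac:(lia)). lra. }
      assert (L : locally (rate z s) (fun t => Rabs (2 / t - 2 / rate z s) < eta / 2)).
      { apply (C (fun t => Rabs (t - 2 / rate z s) < eta / 2)).
        apply locally_R. exists (eta / 2). split; [lra | trivial]. }
      apply locally_R in L. destruct L as [e2 [He2 X2]].
      exists (Rmin e1 e2). split; [now apply Rmin_glb_lt |].
      intros w Hw. assert (M1 := Rmin_l e1 e2). assert (M2 := Rmin_r e1 e2).
      assert (Y1 : close_pair e1 w z) by (destruct Hw; split; lra).
      assert (Y2 := close_pair_rate _ _ _ s Hw).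
      specialize (X1 w Y1). specialize (X2 (rate w s) ltac:(lra)).
      simpl tiling. fold (tile w s) (tile z s) in X2.
      apply Rabs_def2 in X1. apply Rabs_def2 in X2. apply Rabs_def1; lra.
Qed.

(** If the largest index fails at some [e0], it fails for all smaller tolerances by monotonicity, so
    the remaining indices serve every tolerance and the range shrinks. *)
Lemma pigeonhole_small (A : R -> nat -> Prop) :
  (forall e e' n, e' <= e -> A e' n -> A e n) ->
  forall K, (forall e, 0 < e -> exists n, (n <= K)%nat /\ A e n) ->
  exists n, forall e, 0 < e -> A e n.
Proof.
  intros Hmono K. induction K as [| K IH]; intros H.
  - exists 0%nat. intros e He. destruct (H e He) as [n [Hn Ha]].
    now replace 0%nat with n by lia.
  - destruct (classic (forall e, 0 < e -> A e (S K))) as [Y | N]; [now exists (S K) |].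
    apply not_all_ex_not in N. destruct N as [e0 N]. apply imply_to_and in N.
    destruct N as [He0 N]. apply IH. intros e He.
    destruct (H (Rmin e e0)) as [n [Hn Ha]]; [now apply Rmin_glb_lt |].
    exists n. split.
    + assert (n <> S K); [| lia]. intros ->. apply N.
      revert Ha. apply Hmono, Rmin_r.
    + revert Ha. apply Hmono, Rmin_l.
Qed.

(** Near [z] the arcs have a common minimal length, so only finitely many types [(s, n)] occur and
    one of them occurs at every scale. An arc that fits into the unit interval has rate at least 2;
    the rates that occur stay away from 0, and the length of a tiling of fixed type depends
    continuously on them. *)
Lemma tiled_closed (z : R * R) :
  (forall e, 0 < e -> exists w r, r < 1 + e /\ close_pair e w z /\ tiled r w) ->
  tiled 1 z.
Proof.
  intros H.
  set (A := fun e s n => exists w r, r < 1 + e /\ close_pair e w z /\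
    (1 <= n)%nat /\ 0 < rate w s /\ ((2 <= n)%nat -> 0 < rate w (negb s)) /\
    tiling (tile w) s n <= 1 <= r * tiling (tile w) s n).
  assert (Amono : forall s e e' n, e' <= e -> A e' s n -> A e s n).
  { intros s e e' n He [w [r [Hr [[Hc1 Hc2] Ha]]]]. exists w, r.
    split; [lra |]. split; [split; lra | exact Ha]. }
  (* The summand 1 accounts for the distance of [w] from [z], kept below 1 by taking the tolerance
     [Rmin e 1]. *)
  set (delta := 2 / (Rabs (fst z) + Rabs (snd z) + 1)).
  assert (P1 := Rabs_pos (fst z)). assert (P2 := Rabs_pos (snd z)).
  assert (Hdel : 0 < delta) by (apply Rdiv_lt_0_compat; lra).
  destruct (INR_unbounded (1 / delta)) as [K HK].
  assert (HK' : 1 < INR K * delta).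
  { apply Rmult_lt_reg_r with (/ delta); [now apply Rinv_0_lt_compat |].
    rewrite Rmult_assoc, Rinv_r; lra. }
  assert (X : exists s n, forall e, 0 < e -> A e s n).
  { destruct (pigeonhole_small (fun e n => A e true n \/ A e false n)) with (K := K)
      as [n Hn].
    - intros e e' n He [Ha | Ha]; [left | right]; revert Ha; now apply Amono.
    - intros e He.
      destruct (H (Rmin e 1)) as [w [r [Hr [Hc [s [n [T1 [T2 [T3 T4]]]]]]]]].
      { apply Rmin_glb_lt; lra. }
      assert (M1 := Rmin_l e 1). assert (M2 := Rmin_r e 1).
      assert (Q : A e s n).
      { apply (Amono s e (Rmin e 1) n M1). exists w, r. tauto. }
      exists n. split; [| destruct s; [now left | now right]].
      apply INR_le. apply Rnot_lt_le. intros L.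
      assert (Y := tiling_lower w delta).
      assert (INR n * delta <= tiling (tile w) s n).
      { apply Y; [| intros _; exact T2 | exact T3].
        intros s' Hs'. unfold tile, delta, Rdiv.
        apply Rmult_le_compat_l; [lra |]. apply Rinv_le_contravar; [exact Hs' |].
        assert (C := close_pair_rate _ _ _ s' Hc). apply Rabs_def2 in C.
        assert (Rle1 := Rle_abs (fst z)). assert (Rle2 := Rle_abs (snd z)).
        destruct s'; simpl in *; lra. }
      nra.
    - destruct (classic (forall e, 0 < e -> A e true n)) as [Y | N]; [now exists true, n |].
      apply not_all_ex_not in N. destruct N as [e0 N]. apply imply_to_and in N.
      destruct N as [He0 N]. exists false, n. intros e He.
      destruct (Hn (Rmin e e0)) as [Ha | Ha]; [now apply Rmin_glb_lt | |].
      + exfalso. apply N. revert Ha. apply Amono, Rmin_r.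
      + revert Ha. apply Amono, Rmin_l. }
  destruct X as [s [n HA]].
  assert (Hrate : forall s', (forall w, 0 < rate w s' -> tile w s' <= 1 -> 2 <= rate w s')).
  { intros s' w Hw Ht. apply Rmult_le_reg_r with (/ rate w s').
    - now apply Rinv_0_lt_compat.
    - rewrite Rinv_r by lra. exact Ht. }
  assert (Hlim : forall s', (forall e, 0 < e -> exists w, close_pair e w z /\ 2 <= rate w s')
                 -> 0 < rate z s').
  { intros s' Hs'. destruct (Hs' 1 Rlt_0_1) as [w [Hc Hw]].
    assert (C := close_pair_rate _ _ _ s' Hc). apply Rabs_def2 in C. lra. }
  assert (Hn : (1 <= n)%nat).
  { destruct (HA 1 Rlt_0_1) as [w [r [_ [_ [? _]]]]]. assumption. }
  assert (Hz1 : 0 < rate z s).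
  { apply Hlim. intros e He. destruct (HA e He) as [w [r [_ [Hc [_ [G1 [G2 [G3 _]]]]]]]].
    exists w. split; [exact Hc |]. apply Hrate; [exact G1 |].
    destruct n as [| n]; [lia |]. simpl in G3.
    assert (Y := tiling_lower w 0 (fun s H => Rlt_le _ _ (tile_pos w s H)) n (negb s)).
    rewrite Rmult_0_r in Y.
    assert (0 <= tiling (tile w) (negb s) n); [| lra].
    apply Y; [intros; apply G2; lia |]. intros _. now rewrite Bool.negb_involutive. }
  assert (Hz2 : (2 <= n)%nat -> 0 < rate z (negb s)).
  { intros Hn2. apply Hlim. intros e He.
    destruct (HA e He) as [w [r [_ [Hc [_ [G1 [G2 [G3 _]]]]]]]].
    exists w. split; [exact Hc |]. apply Hrate; [now apply G2 |].
    destruct n as [| [| n]]; try lia. simpl in G3. rewrite Bool.negb_involutive in G3.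
    assert (Y := tiling_lower w 0 (fun s H => Rlt_le _ _ (tile_pos w s H)) n s).
    rewrite Rmult_0_r in Y.
    assert (Q := tile_pos w s G1).
    assert (0 <= tiling (tile w) s n); [| lra].
    apply Y; [intros _; exact G1 |]. intros _. now apply G2. }
  exists s, n. split; [exact Hn |]. split; [exact Hz1 |]. split; [exact Hz2 |].
  rewrite Rmult_1_l.
  split.
  - apply (Rle_of_small_slack _ _ 1 1); try lra. intros eta Heta.
    destruct (tiling_cont z n s (fun _ => Hz1) Hz2 eta (proj1 Heta)) as [e [He C]].
    destruct (HA e He) as [w [r [_ [Hc [_ [_ [_ [G _]]]]]]]].
    specialize (C w Hc). apply Rabs_def2 in C. lra.
  (* One [eta] is lost in the lengths and one in [r], as the tiling for [w] has length at most 1. *)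
  - apply (Rle_of_small_slack _ _ 2 1); try lra. intros eta Heta.
    destruct (tiling_cont z n s (fun _ => Hz1) Hz2 eta (proj1 Heta)) as [e [He C]].
    destruct (HA (Rmin e eta)) as [w [r [Hr [Hc [_ [R1 [R2 [G1 G2]]]]]]]].
    { now apply Rmin_glb_lt. }
    assert (M1 := Rmin_l e eta). assert (M2 := Rmin_r e eta).
    assert (Hc' : close_pair e w z) by (destruct Hc; split; lra).
    specialize (C w Hc'). apply Rabs_def2 in C.
    assert (Y := tiling_lower w 0 (fun s H => Rlt_le _ _ (tile_pos w s H))
                   n s (fun _ => R1) R2).
    rewrite Rmult_0_r in Y. nra.
Qed.

(** * The curves *)

Lemma tiling_even (len : bool -> R) (s : bool) (m : nat) :
  tiling len s (2 * m) = INR m * (len s + len (negb s)).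
Proof.
  induction m as [| m IH]; [simpl; ring |].
  replace (2 * S m)%nat with (S (S (2 * m))) by lia.
  cbn [tiling]. rewrite Bool.negb_involutive, IH, S_INR. ring.
Qed.

Lemma tiling_odd (len : bool -> R) (s : bool) (m : nat) :
  tiling len s (2 * m + 1) = (INR m + 1) * len s + INR m * len (negb s).
Proof.
  replace (2 * m + 1)%nat with (S (2 * m)) by lia.
  cbn [tiling]. rewrite tiling_even, Bool.negb_involutive. ring.
Qed.

Lemma Sigma_infty_tiled (z : R * R) : Sigma_infty z <-> tiled 1 z.
Proof.
  split; [| apply Sigma_infty_of_tiled].
  intros [u [Hnt Hu]]. now apply (tiled_of_infty_fucik z u).
Qed.

(** The curve parameter is the ratio [b / a], and multiplying the tiling equation by [a] and by [b]
    produces the two coordinates. For odd [n] a positive first arc means one more positive than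
    negative arc, which corresponds to [curve_minus]. *)
Lemma curves_of_tiled (z : R * R) :
  tiled 1 z -> positive_quadrant z -> infty_curves z.
Proof.
  intros [s [n [Hn [_ [_ Ht]]]]] [Ha Hb].
  assert (E : tiling (tile z) s n = 1) by lra. clear Ht.
  destruct z as [a b]. simpl in *.
  exists n. split; [exact Hn |].
  assert (Hba : 0 < b / a) by (now apply Rdiv_lt_0_compat).
  destruct (Nat.Even_or_Odd n) as [[m ->] | [m ->]]; [left | right].
  - split; [now exists m |]. rewrite tiling_even in E.
    assert (E' : INR m * (2 / a + 2 / b) = 1).
    { rewrite <- E. unfold tile. destruct s; simpl; ring. }
    exists (b / a). split; [exact Hba |].
    rewrite mult_INR. simpl (INR 2). f_equal.
    + replace ((1 + 1) * INR m * (1 + / (b / a))) with (INR m * (2 / a + 2 / b) * a)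
        by (field; lra).
      rewrite E'. ring.
    + replace ((1 + 1) * INR m * (1 + b / a)) with (INR m * (2 / a + 2 / b) * b)
        by (field; lra).
      rewrite E'. ring.
  - split; [now exists m |]. rewrite tiling_odd in E. unfold tile in E.
    destruct s; simpl in E; [right | left]; exists (b / a); (split; [exact Hba |]);
      rewrite plus_INR, mult_INR; simpl (INR 2); simpl (INR 1).
    + f_equal.
      * replace a with (a * ((INR m + 1) * (2 / a) + INR m * (2 / b))) at 1
          by (rewrite E; ring). field. lra.
      * replace b with (b * ((INR m + 1) * (2 / a) + INR m * (2 / b))) at 1
          by (rewrite E; ring). field. lra.
    + f_equal.
      * replace a with (a * ((INR m + 1) * (2 / b) + INR m * (2 / a))) at 1
          by (rewrite E; ring). field. lra.
      * replace b with (b * ((INR m + 1) * (2 / b) + INR m * (2 / a))) at 1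
          by (rewrite E; ring). field. lra.
Qed.

Lemma tiled_of_curves (z : R * R) :
  infty_curves z -> tiled 1 z /\ positive_quadrant z.
Proof.
  intros [k [Hk H]].
  assert (T : forall s, positive_quadrant z -> tiling (tile z) s k = 1 ->
                        tiled 1 z /\ positive_quadrant z).
  { intros s Hz E. split; [| exact Hz]. exists s, k. destruct Hz as [Ha Hb].
    rewrite E. repeat split; try lra; try assumption; try (intros _); destruct s; assumption. }
  destruct H as [[[m ->] [s [Hs ->]]] | [[m ->] [[s [Hs ->]] | [s [Hs ->]]]]];
    assert (His := Rinv_0_lt_compat s Hs).
  - rewrite mult_INR in *. simpl (INR 2) in *.
    assert (Hm : 1 <= INR m) by (apply (le_INR 1); lia).
    apply (T true).
    + split; simpl; nra.
    + rewrite tiling_even. unfold tile. simpl. field. repeat split; nra.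
  - rewrite plus_INR, mult_INR in *. simpl (INR 2) in *. simpl (INR 1) in *.
    assert (Hm := pos_INR m).
    apply (T false).
    + split; simpl; nra.
    + rewrite tiling_odd. unfold tile. simpl. field. repeat split; nra.
  - rewrite plus_INR, mult_INR in *. simpl (INR 2) in *. simpl (INR 1) in *.
    assert (Hm := pos_INR m).
    apply (T true).
    + split; simpl; nra.
    + rewrite tiling_odd. unfold tile. simpl. field. repeat split; nra.
Qed.

(** Two arcs would make both rates positive. Hence there is a single arc, of length 1 and rate 2,
    and the rate of the other sign can be any nonpositive number. *)
Lemma tiled_outside_quadrant (z : R * R) :
  tiled 1 z /\ ~ positive_quadrant z <->
  (fst z = 2 /\ snd z <= 0) \/ (fst z <= 0 /\ snd z = 2).
Proof.
  unfold positive_quadrant. split.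
  - intros [[s [n [Hn [H1 [H2 Ht]]]]] Hz].
    assert (n = 1%nat) as ->.
    { apply NNPP. intros N. apply Hz.
      assert (Q := H2 ltac:(lia)). destruct s; simpl in *; lra. }
    simpl in Ht. unfold tile in Ht.
    assert (E : 2 / rate z s = 1) by lra.
    assert (E' : rate z s = 2).
    { replace (rate z s) with (2 / (2 / rate z s)) by (field; lra). rewrite E. field. }
    destruct s; simpl in *; [left | right]; lra.
  - intros [[H1 H2] | [H1 H2]]; (split; [| lra]); [exists true | exists false];
      exists 1%nat; unfold tile; simpl; [rewrite H1 | rewrite H2];
      repeat split; try lia; lra.
Qed.

Lemma lower_limit_of_tiled (z : R * R) :
  tiled 1 z -> nonneg_quadrant z -> lower_limit Sigma_p_rescaled z.
Proof.
  intros Ht Hz eps.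
  assert (Hz' := Hz). destruct Hz' as [Hz1 Hz2].
  set (c := fst z + snd z + 1). assert (Hc : 0 < c) by (unfold c; lra).
  set (e := Rmin 1 (eps / (4 * c))).
  assert (Heps := cond_pos eps).
  assert (He0 : 0 < eps / (4 * c)) by (apply Rdiv_lt_0_compat; lra).
  assert (He : 0 < e) by (apply Rmin_glb_lt; lra).
  assert (M1 := Rmin_l 1 (eps / (4 * c))). fold e in M1.
  assert (M2 : e * c <= eps / 4).
  { replace (eps / 4) with (eps / (4 * c) * c) by (field; lra).
    apply Rmult_le_compat_r; [lra | apply Rmin_r]. }
  destruct (eventually_ratio e He) as [P [HP2 HP]].
  exists (Rmax P (1 + / e)). intros p Hp.
  assert (N1 := Rmax_l P (1 + / e)). assert (N2 := Rmax_r P (1 + / e)).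
  assert (Hr := HP p ltac:(lra)).
  destruct (Sigma_p_rescaled_of_tiled p) as [rho [Hrho Hsig]]; [lra |].
  exists (rho * fst z, rho * snd z). split; [now apply Hsig |].
  assert (Hq : p / (p - 1) < 1 + e).
  { assert (/ (p - 1) < e).
    { rewrite <- (Rinv_inv e). assert (0 < / e) by (now apply Rinv_0_lt_compat).
      apply Rinv_lt_contravar; nra. }
    replace (p / (p - 1)) with (1 + / (p - 1)) by (field; lra). lra. }
  assert (Hq1 : 0 < p / (p - 1)) by (apply Rdiv_lt_0_compat; lra).
  (* Both factors of the bound on [rho] are below [1 + e], and [(1 + e)^2 <= 1 + 3 e] because
     [e <= 1]; the choice [e c <= eps / 4] then suffices. *)
  assert (Hrho2 : rho < 1 + 3 * e) by nra.
  assert (B : forall t, 0 <= t <= c -> Rabs (rho * t - t) < eps).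
  { intros t Htc. rewrite Rabs_pos_eq by nra.
    assert ((rho - 1) * t <= 3 * e * c) by (apply Rmult_le_compat; lra). lra. }
  split; simpl; apply B; unfold c; lra.
Qed.

(** Tilings pass to the limit by closedness, and nonnegativity of the coordinates is inherited from
    the p-th roots. *)
Lemma tiled_of_upper_limit (z : R * R) :
  upper_limit Sigma_p_rescaled z -> tiled 1 z /\ nonneg_quadrant z.
Proof.
  intros H. split.
  - apply tiled_closed. intros e He.
    destruct (eventually_ratio e He) as [P [HP2 HP]].
    destruct (H (mkposreal e He) P) as [p [Hp [w [Hw [B1 B2]]]]].
    exists w, (arc_ratio p). split; [now apply HP |]. split.
    + split; assumption.
    + apply tiled_of_Sigma_p_rescaled; [lra | exact Hw].
  - assert (G : forall e, 0 < e -> - e <= fst z /\ - e <= snd z).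
    { intros e He. destruct (H (mkposreal e He) 0) as [p [_ [w [Hw [B1 B2]]]]].
      destruct Hw as [z' [_ [_ ->]]]. simpl in B1, B2.
      assert (R1 := rpow_ge0 (fst z') (/ p)). assert (R2 := rpow_ge0 (snd z') (/ p)).
      apply Rabs_def2 in B1. apply Rabs_def2 in B2.
      unfold minus, plus, opp in B1, B2; simpl in B1, B2. lra. }
    split; apply Rnot_lt_le; intros L.
    + destruct (G (- fst z / 2)); lra.
    + destruct (G (- snd z / 2)); lra.
Qed.

Theorem theorem1p2 :
  is_set_limit Sigma_p_rescaled
    (fun z => Sigma_infty z /\ nonneg_quadrant z) /\
  (forall z : R * R,
     (Sigma_infty z /\ positive_quadrant z) <-> infty_curves z) /\
  (forall z : R * R,
     (Sigma_infty z /\ ~ positive_quadrant z) <->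
     (fst z = 2 /\ snd z <= 0) \/ (fst z <= 0 /\ snd z = 2)).
Proof.
  split; [| split]; intros z.
  - rewrite Sigma_infty_tiled.
    (* The lower limit is always contained in the upper one, so it remains to put the upper limit
       inside the tiled set and the nonnegative tiled points inside the lower limit. *)
    assert (A : lower_limit Sigma_p_rescaled z -> upper_limit Sigma_p_rescaled z).
    { intros H eps P. destruct (H eps) as [M HM].
      exists (Rmax M P + 1). assert (M1 := Rmax_l M P). assert (M2 := Rmax_r M P).
      split; [lra | apply HM; lra]. }
    split; split.
    + intros H. now apply tiled_of_upper_limit, A.
    + intros [H1 H2]. now apply lower_limit_of_tiled.
    + apply tiled_of_upper_limit.
    + intros [H1 H2]. now apply A, lower_limit_of_tiled.
  - rewrite Sigma_infty_tiled. split.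
    + intros [H1 H2]. now apply curves_of_tiled.
    + apply tiled_of_curves.
  - rewrite Sigma_infty_tiled. apply tiled_outside_quadrant.
Qed.
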